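(* Let $G=(V,E)$ be an infinite, connected, locally finite simple graph such that the wired spanning forest of $G$ is $\mu$-a.s. connected (a single tree) and has one end. Then there exists a probability measure $\nu$ on $\Omega_G=\prod_{x\in V}\{0,\dots,\deg_G(x)-1\}$ such that $\nu_{G_n}\Rightarrow\nu$ (weak convergence, i.e. convergence of all finite-dimensional marginals) for every exhaustion $V_1\subset V_2\subset\cdots$ of $V$, and $\nu$ does not depend on the exhaustion.
   Context: An exhaustion of $V$ is a sequence of finite sets $V_1\subset V_2\subset\cdots$ with $\bigcup_nV_n=V$. The wired graph $G_n$ is obtained from $G$ by identifying all vertices of $V\setminus V_n$ to a single vertex $s$ (the sink) and removing loops at $s$; thus every $x\in V_n$ has $\deg_{G_n}(x)=\deg_G(x)$. $\mu_{G_n}$ is the uniform measure on spanning trees of $G_n$; the wired spanning forest (WSF) measure $\mu$ on $\{0,1\}^E$ is the weak limit of $\mu_{G_n}$, which exists, is independent of the exhaustion, and is concentrated on spanning forests all of whose components are infinite. An infinite tree has one end if any two infinite self-avoiding paths in it share infinitely many vertices. $\nu_{G_n}$ is the stationary distribution of the Abelian sandpile Markov chain on $G_n$ with sink $s$ (uniform on recurrent configurations; the chain adds a particle at a random vertex of $V_n$ and stabilizes by topplings, a vertex $x$ with at least $\deg(x)$ particles sending one particle to each neighbour, particles sent to $s$ being lost), a measure on $\prod_{x\in V_n}\{0,\dots,\deg_G(x)-1\}$. *)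

(* Defs.v *)
From mathcomp Require Import all_boot all_order all_algebra.
From mathcomp Require Import all_classical all_reals all_analysis.

Set Implicit Arguments.
Unset Strict Implicit.
Unset Printing Implicit Defensive.

Import Order.TTheory GRing.Theory Num.Theory.
Import numFieldNormedType.Exports.
Local Open Scope classical_set_scope.

Inductive rtc {T : Type} (r : T -> T -> Prop) : T -> T -> Prop :=
| rtc_refl x : rtc r x x
| rtc_step x y z : r x y -> rtc r y z -> rtc r x z.

(* Graphs.  A locally finite graph on a countable vertex type V is      *)
(* given by its neighbour lists nb x (so deg x = size (nb x) < oo).     *)
Section Graph.
Variables (V : countType) (nb : V -> seq V).

Definition adj (x y : V) : bool := y \in nb x.

Definition deg (x : V) : nat := size (nb x).

Definition simple_graph : Prop :=
  [/\ forall x, uniq (nb x), forall x y, adj x y = adj y x & forall x, ~~ adj x x].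

Definition connected_graph : Prop :=
  forall x y : V, exists s : seq V, path adj x s /\ last x s = y.

(* Edge set E: each unordered edge {x,y} is represented once, by the  *)
(* ordered pair (x,y) with pickle x < pickle y.                        *)
Definition edge : Type :=
  {p : V * V | adj p.1 p.2 && (pickle p.1 < pickle p.2)%N}.

Definition exhaustion (Vn : nat -> set V) : Prop :=
  [/\ forall n, finite_set (Vn n),
      forall n, Vn n `<=` Vn n.+1
    & forall x, exists n, Vn n x].

Section Wired.
Variables (Vn : nat -> set V) (n : nat).

Definition in_Gn (e : edge) : Prop := Vn n (val e).1 \/ Vn n (val e).2.

(* vertex of G_n a vertex of G is mapped to (None = the sink s) *)
Definition wire (x : V) : option V :=
  if pselect (Vn n x) then Some x else None.

Definition wedge (T : edge -> bool) (a b : option V) : Prop :=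
  exists e : edge, [/\ T e, in_Gn e &
    ((wire (val e).1 = a /\ wire (val e).2 = b) \/
     (wire (val e).2 = a /\ wire (val e).1 = b))].

Definition wconn (T : edge -> bool) (a b : option V) : Prop :=
  exists (k : nat) (p : nat -> option V),
    [/\ p 0%N = a, p k = b & forall i, (i < k)%N -> wedge T (p i) (p i.+1)].

Definition wconnected (T : edge -> bool) : Prop :=
  forall x, Vn n x -> wconn T (Some x) None.

Definition spanning_tree (T : edge -> bool) : Prop :=
  [/\ forall e, T e -> in_Gn e,
      wconnected T
    & forall e, T e -> ~ wconnected (fun f => T f && (f != e))].

(* configurations on V_n are represented by eta : V -> nat vanishing  *)
(* outside V_n                                                        *)
Definition supported (eta : V -> nat) : Prop := forall x, ~ Vn n x -> eta x = 0%N.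

Definition stable (eta : V -> nat) : Prop :=
  supported eta /\ forall x, Vn n x -> (eta x < deg x)%N.

(* legal toppling of an unstable vertex x of V_n; particles sent to   *)
(* neighbours outside V_n (i.e. to the sink) are lost                  *)
Definition topple (eta eta' : V -> nat) : Prop :=
  exists x, [/\ Vn n x, (deg x <= eta x)%N &
    forall y, eta' y =
      if y == x then (eta x - deg x)%N
      else if adj x y && `[< Vn n y >] then (eta y).+1 else eta y].

Definition stabilizes (eta zeta : V -> nat) : Prop :=
  rtc topple eta zeta /\ stable zeta.

Definition add_particle (x : V) (eta : V -> nat) : V -> nat :=
  fun y => if y == x then (eta y).+1 else eta y.

(* one step of the sandpile chain has positive probability from eta  *)
(* to zeta: add a particle at some vertex of V_n and stabilize         *)
Definition sandpile_step (eta zeta : V -> nat) : Prop :=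
  stable eta /\ exists x, Vn n x /\ stabilizes (add_particle x eta) zeta.

Definition recurrent (eta : V -> nat) : Prop :=
  stable eta /\
  forall zeta, rtc sandpile_step eta zeta -> rtc sandpile_step zeta eta.

Local Open Scope ring_scope.
Variable R : realType.

Definition ust_cyl (F : seq edge) (w0 : edge -> bool) : R :=
  (\sum_(T \in [set T | spanning_tree T /\ forall e, e \in F -> T e = w0 e]) (1 : R))
  / (\sum_(T \in [set T | spanning_tree T]) (1 : R)).

Definition sandpile_cyl (F : seq V) (xi : V -> nat) : R :=
  (\sum_(eta \in [set eta | recurrent eta /\ forall x, x \in F -> eta x = xi x]) (1 : R))
  / (\sum_(eta \in [set eta | recurrent eta]) (1 : R)).

End Wired.

Section Forest.
Variable w : edge -> bool.

Definition open_edge (x y : V) : Prop :=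
  exists e : edge, w e /\ (val e = (x, y) \/ val e = (y, x)).

Definition forest_connected : Prop :=
  forall x y, exists (k : nat) (p : nat -> V),
    [/\ p 0%N = x, p k = y & forall i, (i < k)%N -> open_edge (p i) (p i.+1)].

Definition forest_acyclic : Prop :=
  ~ exists (k : nat) (p : nat -> V),
    [/\ (3 <= k)%N,
        forall i j, (i < k)%N -> (j < k)%N -> p i = p j -> i = j,
        forall i, (i.+1 < k)%N -> open_edge (p i) (p i.+1)
      & open_edge (p k.-1) (p 0%N)].

Definition open_ray (p : nat -> V) : Prop :=
  injective p /\ forall i, open_edge (p i) (p i.+1).

Definition one_end : Prop :=
  forall p q, open_ray p -> open_ray q ->
    forall N, exists i j, (N <= i)%N /\ p i = q j.

Definition one_ended_spanning_tree : Prop :=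
  [/\ forest_connected, forest_acyclic & one_end].

End Forest.

End Graph.

Definition cyl_sets (I X : Type) : set (set (I -> X)) :=
  [set A | exists (i : I) (x : X), A = [set f | f i = x]].

Notation edge_space nb := (g_sigma_algebraType (@cyl_sets (edge nb) bool)).
(* configurations V -> nat with the product sigma-algebra; Omega_G is *)
(* the (measurable) subset of configurations with eta x < deg x       *)
Notation config_space V := (g_sigma_algebraType (@cyl_sets V nat)).

Definition Omega (V : countType) (nb : V -> seq V) : set (V -> nat) :=
  [set eta | forall x, (eta x < deg nb x)%N].

Definition is_WSF (R : realType) (V : countType) (nb : V -> seq V)
  (mu : probability (edge_space nb) R) : Prop :=
  forall Vn, exhaustion Vn -> forall (F : seq (edge nb)) (w0 : edge nb -> bool),
    ((fun n => @ust_cyl V nb Vn n R F w0) : nat -> R) @ \oo -->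
      (fine (mu [set w | forall e, e \in F -> w e = w0 e]) : R).

(* Main.v *)
Require Import Defs.
From mathcomp Require Import all_boot all_order all_algebra.
From mathcomp Require Import all_classical all_reals all_analysis.
From mathcomp Require finmap.
From mathcomp Require Import zify lra.
Import Order.TTheory GRing.Theory Num.Theory.
Import numFieldNormedType.Exports.
Local Open Scope classical_set_scope.

Set Implicit Arguments.
Unset Strict Implicit.
Unset Printing Implicit Defensive.

(** By the theory of Dhar, the recurrent configurations of a wired graph are the
    stable ones without forbidden subconfiguration ([allowed]), and the burning
    bijection of Majumdar and Dhar identifies them with the spanning trees.
    Orienting a tree towards the sink, the height at [x] depends only on the
    vertex following [x] and on the differences between the distances to the
    sink of [x] and of its neighbours.

    In a one-ended tree, every finite set of vertices lies in a finite set [D]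
    which a single tree edge leaves.  A spanning tree of a large wired graph
    that looks the same near [D] also leaves [D] through this edge only, which
    fixes the distances to the sink on [D] up to a common constant, and with
    them the heights.  So a local event [P] for the heights is forced by a
    countable union of cylinder events for the tree, and the same holds for its
    complement; the two unions cover the forest almost surely.  Each of them
    bounds from below the limiting frequency of its event, and as the bounds
    add up to 1 the frequencies converge.  The limit measure is the image of
    the forest measure under the map reading the heights off these events. *)

(** * Finite sequences, minima and reflexive-transitive closures *)

Lemma finite_set_enum (T : choiceType) (A : set T) :
  finite_set A -> exists2 s : seq T, uniq s & forall x, A x <-> x \in s.
Proof.
move=> /finite_seqP[s ->]; exists (undup s); first exact: undup_uniq.
by move=> x /=; rewrite mem_undup.
Qed.

Lemma seq_argmax (T : eqType) (u : T -> nat) (x0 : T) (s : seq T) :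
  x0 \in s -> exists2 x, x \in s & forall y, y \in s -> u y <= u x.
Proof.
elim: s x0 => // a s IH x0 _; case: s IH => [|b s] IH.
  by exists a; [rewrite mem_head | move=> y; rewrite inE => /eqP->].
have [x xs xmax] := IH b (mem_head _ _).
case: (leqP (u x) (u a)) => xa.
  exists a; first exact: mem_head.
  by move=> y; rewrite inE => /predU1P[->//|/xmax/leq_trans]; apply.
exists x; first by rewrite inE xs orbT.
by move=> y; rewrite inE => /predU1P[->|/xmax//]; exact: ltnW.
Qed.

Lemma seq_bound (T : eqType) (u : T -> nat) (s : seq T) :
  exists B, forall x, x \in s -> u x <= B.
Proof.
by exists (\max_(x <- s) u x) => x xs; apply: leq_bigmax_seq.
Qed.

Lemma prop_argmin (T : Type) (A : T -> Prop) (d : T -> nat) :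
  (exists x, A x) -> exists2 x, A x & forall y, A y -> d x <= d y.
Proof.
move=> [x0 Ax0]; pose P k := `[< exists2 x, A x & d x = k >].
have exP : exists k, P k by exists (d x0); apply/asboolP; exists x0.
case: (ex_minnP exP) => k /asboolP[x Ax <-] H.
by exists x => // y Ay; apply: H; apply/asboolP; exists y.
Qed.

Lemma leq_sum_const (T : eqType) (r : seq T) (g : T -> nat) (m : nat) :
  (forall y, y \in r -> g y <= m) -> \sum_(y <- r) g y <= size r * m.
Proof.
elim: r => [|a r IH] H; first by rewrite big_nil.
rewrite big_cons mulSn leq_add ?H ?mem_head// IH// => y yr.
by rewrite H// inE yr orbT.
Qed.

Lemma count_remove (T : eqType) (A : pred T) (v : T) (l : seq T) : uniq l ->
  count A l = count [pred z | A z && (z != v)] l + (A v && (v \in l)).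
Proof.
elim: l => [|a l IHl] /=; first by rewrite andbF.
move=> /andP[al /IHl ->]; rewrite inE (eq_sym a v).
by case: eqP => [->|_] /=; [rewrite (negbTE al) | rewrite andbT]; case: (A v) => /=; lia.
Qed.

Lemma rtc_trans (T : Type) (r : T -> T -> Prop) x y z :
  rtc r x y -> rtc r y z -> rtc r x z.
Proof. by elim=> // {}x w {}y xw _ IH /IH; apply: rtc_step. Qed.

Lemma rtc_ind_inv (T : Type) (r : T -> T -> Prop) (P : T -> Prop) x y :
  (forall a b, P a -> r a b -> P b) -> P x -> rtc r x y -> P y.
Proof. by move=> HP + xy; elim: xy => // {}x w {}y xw _ IH /HP/(_ xw). Qed.

Section Graph.
Variables (V : countType) (nb : V -> seq V).
Hypothesis simp : simple_graph nb.
Notation deg := (deg nb).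

Let nb_uniq x : uniq (nb x). Proof. by case: simp. Qed.
Let nb_sym x y : (x \in nb y) = (y \in nb x).
Proof. by case: simp => _ /(_ y x). Qed.
Let nb_irr x : x \in nb x = false.
Proof. by case: simp => _ _ /(_ x)/negbTE. Qed.

(* A spanning tree of the wired graph on W, oriented towards the sink: [f x] is
   the next vertex on the path from [x] to the sink, [d x] its length. *)
Definition rooted (W : set V) (d : V -> nat) (f : V -> V) : Prop :=
  (forall x, ~ W x -> d x = 0 /\ f x = x) /\
  (forall x, W x -> f x \in nb x /\ d x = (d (f x)).+1).

(** A set [A] violating the condition is a forbidden subconfiguration: each of its vertices has
    fewer particles than neighbours in [A]. *)
Definition allowed (W : set V) (eta : V -> nat) : Prop :=
  forall A : pred V, (forall x, A x -> W x) -> (exists x, A x) ->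
  exists2 x, A x & count A (nb x) <= eta x.

(** * Recurrent configurations *)

Section Sandpile.
Variables (Vn : nat -> set V) (n : nat) (s : seq V).
Hypothesis us : uniq s.
Hypothesis Ws : forall x, Vn n x <-> x \in s.
Notation W := (Vn n).
Notation topple := (topple nb Vn n).
Notation stable := (stable nb Vn n).
Notation supported := (supported Vn n).
Notation stabilizes := (stabilizes nb Vn n).
Notation sandpile_step := (sandpile_step nb Vn n).
Notation recurrent := (recurrent nb Vn n).

Let Wb x : `[< W x >] = (x \in s).
Proof. by apply/asboolP/idP => /Ws. Qed.

Definition toppled (x : V) (eta : V -> nat) : V -> nat := fun y =>
  if y == x then eta x - deg x
  else if (y \in nb x) && (y \in s) then (eta y).+1 else eta y.

Lemma toppleP eta eta' : topple eta eta' <->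
  exists2 x, (x \in s) && (deg x <= eta x) & eta' = toppled x eta.
Proof.
split=> [[x [/Ws xs dx E]]|[x /andP[/Ws xs dx] ->]].
  exists x; first by rewrite xs.
  by apply/funext => y; rewrite E /toppled Wb.
by exists x; split=> // y; rewrite /toppled Wb.
Qed.

Lemma supportedP eta : supported eta <-> forall x, x \notin s -> eta x = 0.
Proof.
split=> H x xs; apply: H; first by move=> /Ws; apply/negP.
by apply/negP => /Ws.
Qed.

Lemma toppled_supported x eta : x \in s -> supported eta ->
  supported (toppled x eta).
Proof.
move=> xs /supportedP e0; apply/supportedP => y ys; rewrite /toppled.
case: eqP => [yx|_]; first by rewrite yx xs in ys.
by rewrite (negbTE ys) andbF e0.
Qed.

Lemma stableP eta : stable eta <->
  supported eta /\ forall x, x \in s -> eta x < deg x.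
Proof. by split=> -[? H]; split=> // x /Ws; exact: H. Qed.

Lemma sum_nb_supported (h : V -> nat) x : (forall y, y \notin s -> h y = 0) ->
  \sum_(y <- nb x) h y = \sum_(y <- s | y \in nb x) h y.
Proof.
move=> h0; rewrite (bigID (mem s))/= [X in _ + X]big1 ?addn0; last by move=> y /h0.
rewrite -big_filter -[RHS]big_filter; apply/perm_big/uniq_perm.
- exact/filter_uniq.
- exact/filter_uniq.
- by move=> y; rewrite !mem_filter/= andbC.
Qed.

(** Toppling takes [deg x] particles of weight [h x] away and puts one of weight [h y] on each
    neighbour [y]; particles lost in the sink weigh nothing. The additive form avoids truncated
    subtraction. *)
Lemma toppled_weight (h eta : V -> nat) x : (forall y, y \notin s -> h y = 0) ->
  x \in s -> deg x <= eta x ->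
  \sum_(y <- s) h y * toppled x eta y + deg x * h x =
  \sum_(y <- s) h y * eta y + \sum_(y <- nb x) h y.
Proof.
move=> h0 xs dx; rewrite sum_nb_supported// !(bigD1_seq x)//=.
rewrite {1}/toppled eqxx.
have -> : \sum_(y <- s | y != x) h y * toppled x eta y =
   \sum_(y <- s | y != x) h y * eta y + \sum_(y <- s | y \in nb x) h y.
  rewrite [X in _ + X]big_mkcond [X in _ + X](bigD1_seq x)//= nb_irr add0n.
  rewrite -big_split big_seq_cond [RHS]big_seq_cond /=.
  apply: eq_bigr => y /andP[ys yx]; rewrite /toppled (negbTE yx) ys andbT.
  by case: ifP => _; rewrite ?addn0 // mulnS addnC.
have := leq_mul (leqnn (h x)) dx; rewrite mulnBr [deg x * _]mulnC.
by move=> le; rewrite addnAC subnK// addnA.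
Qed.

(** Here [u] prescribes how often each vertex topples, and the equation says that these topplings
    turn [c] into [eta]. To find a legal first one, apply [allowed] to the set where [u] is maximal:
    the vertex it gives has smaller [u] at its neighbours outside this set, and the equation then
    forces [deg x <= c x]. *)
Lemma burn_down eta u c : allowed W eta -> supported eta ->
  (forall y, y \notin s -> u y = 0) -> supported c ->
  (forall x, x \in s -> c x + \sum_(y <- nb x) u y = eta x + deg x * u x) ->
  rtc topple c eta.
Proof.
move=> alw /supportedP e0.
have [N] := ubnP (\sum_(y <- s) u y); elim: N u c => // N IH u c leN u0 c0 Ec.
have [/hasP[x0 x0s ux0]|/hasPn un] := boolP (has (fun x => 0 < u x) s); last first.
  have uz y : u y = 0.
    have [/un|/u0//] := boolP (y \in s).
    by rewrite lt0n negbK => /eqP.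
  suff -> : c = eta by exact: rtc_refl.
  apply/funext => x; have [xs|xs] := boolP (x \in s).
    by have := Ec _ xs; rewrite big1 // uz muln0 !addn0.
  by rewrite e0//; move/supportedP: c0 => ->.
have [xm xms um] := seq_argmax u x0s.
pose A := [pred y | (y \in s) && (u y == u xm)].
have [|/=|x /andP[xs /eqP xA] cA] := alw A; first by move=> x /andP[/Ws].
  by exists xm; rewrite xms eqxx.
have mpos : 0 < u x by rewrite xA (leq_trans ux0)// um.
have leA : \sum_(y <- nb x) (u y + ~~ A y) <= size (nb x) * u x.
  apply: leq_sum_const => y _; have [/=|ys] := boolP (y \in s); last first.
    by rewrite u0//= (negbTE ys).
  move=> ys; rewrite /A /= ys /= xA; case: eqP => [->|/eqP ne]; first by rewrite addn0.
  by rewrite addn1 ltn_neqAle ne um.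
have dc : deg x <= c x.
  have := Ec _ xs; move: leA cA; rewrite big_split /=.
  have -> : \sum_(y <- nb x) ~~ A y = count (predC A) (nb x).
    by rewrite -sum1_count [RHS]big_mkcond /=; apply: eq_bigr => y _; case: (A y).
  have := count_predC A (nb x); rewrite /Defs.deg.
  move: (\sum_(y <- nb x) u y) (size (nb x)) (size _ * u x) (count A _) (count (predC A) _) => *.
  by lia.
have tx : topple c (toppled x c) by apply/toppleP; exists x; rewrite ?xs.
apply: (rtc_step tx); pose u' y := u y - (y == x).
have uE y : u y = u' y + (y == x).
  by rewrite /u'; case: eqP => [->|]; [rewrite subnK|rewrite subn0 addn0].
have sumE z : \sum_(y <- nb z) u y = \sum_(y <- nb z) u' y + (x \in nb z).
  under eq_bigr do rewrite uE; rewrite big_split /=; congr (_ + _).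
  rewrite -(count_uniq_mem _ (nb_uniq z)) -sum1_count [RHS]big_mkcond /=.
  by apply: eq_bigr => y _; case: eqP.
apply: (IH u').
- rewrite ltnS in leN; apply: leq_trans leN.
  rewrite [X in _ < X](bigD1_seq x)//= (bigD1_seq x)//= -addSn leq_add//.
    by rewrite /u' eqxx subn1 prednK.
  by apply: leq_sum => y yx; rewrite /u' (negbTE yx) subn0.
- by move=> y ys; rewrite /u' u0.
- exact: toppled_supported.
move=> z zs; have := Ec _ zs; rewrite sumE /toppled nb_sym (uE z).
have [->|zx] := eqVneq z x; first by rewrite nb_irr; nia.
by rewrite zs andbT; case: ifP => _ /=; lia.
Qed.

(** Toppling one unstable vertex never lowers another, so two distinct topplings commute. *)
Lemma topple_diamond eta eta1 eta2 : topple eta eta1 -> topple eta eta2 ->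
  eta1 = eta2 \/ exists2 eta3, topple eta1 eta3 & topple eta2 eta3.
Proof.
move=> /toppleP[x /andP[xs dx] ->] /toppleP[y /andP[ys dy] ->].
have [->|xy] := eqVneq x y; [by left|right].
have mon a b : a != b -> eta a <= toppled b eta a.
  by move=> ab; rewrite /toppled (negbTE ab); case: ifP.
exists (toppled y (toppled x eta)); apply/toppleP.
  by exists y => //; rewrite ys (leq_trans dy)// mon// eq_sym.
exists x; first by rewrite xs (leq_trans dx)// mon.
apply/funext => z; rewrite /toppled (eq_sym y x) (negbTE xy).
have [->|zx] := eqVneq z x.
  by rewrite (negbTE xy) ?eqxx xs andbT; case: ifP => _ //; lia.
have [->|zy] := eqVneq z y; first by rewrite ?eqxx ys andbT; case: ifP => _ //; lia.
by case: ifP => _; case: ifP.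
Qed.

Lemma stable_no_topple eta eta' : stable eta -> topple eta eta' -> False.
Proof.
by move=> /stableP[_ st] /toppleP[x /andP[xs dx] _]; have := st _ xs; lia.
Qed.

Lemma topple_confluent eta eta' zeta : stable zeta -> rtc topple eta zeta ->
  rtc topple eta eta' -> rtc topple eta' zeta.
Proof.
move=> sz + ee'; elim: ee' => // {eta eta'} eta eta1 eta' t1 _ IH ez; apply: IH.
elim: ez sz eta1 t1 => {eta zeta eta'} [zeta|eta eta2 zeta t2 t2z IH] sz eta1 t1.
  by have := stable_no_topple sz t1.
have [->//|[eta3 t13 t23]] := topple_diamond t1 t2.
exact: rtc_step t13 (IH sz _ t23).
Qed.

Lemma rtc_topple_add (p eta zeta : V -> nat) : rtc topple eta zeta ->
  rtc topple (fun x => eta x + p x) (fun x => zeta x + p x).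
Proof.
elim=> [*|{eta zeta} eta eta1 zeta t _ IH]; first exact: rtc_refl.
apply: rtc_step IH; move/toppleP: t => [x /andP[xs dx] ->]; apply/toppleP.
exists x; first by rewrite xs (leq_trans dx) ?leq_addr.
apply/funext => y; rewrite /toppled; case: eqP => [->|_]; first by lia.
by case: ifP => _; lia.
Qed.

(** If [A] were forbidden after toppling [v], then [A] without [v] would be forbidden before: a
    neighbour of [v] gains one particle and loses at most one neighbour in the set. The smaller set
    is nonempty because a single vertex is never forbidden. *)
Lemma allowed_topple eta eta' : allowed W eta -> topple eta eta' ->
  allowed W eta'.
Proof.
move=> alw /toppleP[v /andP[vs dv] ->] A AW Ane; apply: contrapT => noA.
have lt x : A x -> toppled v eta x < count A (nb x).
  by move=> Ax; rewrite ltnNge; apply/negP => H; apply: noA; exists x.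
pose A' := [pred x | A x && (x != v)].
have cA' x : count A (nb x) = count A' (nb x) + (A v && (x \in nb v)).
  by rewrite nb_sym (count_remove A v (nb_uniq x)).
have [x||x A'x lex] := alw A'; first by move=> /andP[/AW].
  apply: contrapT => noA'; have [x Ax] := Ane.
  have AE y : A y -> y = v.
    by move=> Ay; apply: contrapT => /eqP yv; apply: noA'; exists y; rewrite /A' /= Ay.
  have := lt x Ax; rewrite (AE x Ax) cA' nb_irr andbF addn0.
  by rewrite (@eq_count _ A' pred0) ?count_pred0// => y /=; apply/negP => /andP[/AE -> /eqP].
case/andP: A'x => Ax xv; have := lt x Ax; rewrite cA' /toppled (negbTE xv) (_ : x \in s).
  by case: (x \in nb v); case: (A v) => /=; rewrite ?addn0 ?addn1 ?ltnS; lia.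
by apply/Ws/AW.
Qed.

Section Recurrent.
Variables (d : V -> nat) (f : V -> V).
Hypothesis rt : rooted W d f.

(** A strictly superharmonic weight: the total weight drops at every toppling, so stabilization
    terminates, and a multiple of it serves as toppling count in [recurrentP]. *)
Lemma exists_weight : exists h : V -> nat, (forall y, y \notin s -> h y = 0) /\
  forall x, x \in s -> \sum_(y <- nb x) h y < deg x * h x.
Proof.
have [L dL] := seq_bound d s; have [B degB] := seq_bound deg s.
(* [M] exceeds every degree in [s], and [a] is [M] times larger at [f x] than at [x], so this one
   neighbour already outweighs [deg x * a x]. *)
pose M := B.+1; pose a y := M ^ (L - d y); exists (fun y => M ^ L - a y).
have out y : y \notin s -> d y = 0.
  by move=> ys; apply: (proj1 (rt.1 y _)) => /Ws; apply/negP.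
split=> [y /out dy|x xs]; first by rewrite /a dy subn0 subnn.
have aM y : a y <= M ^ L by rewrite leq_pexp2l ?leq_subr.
have [fx dx] : f x \in nb x /\ d x = (d (f x)).+1 by apply: rt.2; exact/Ws.
have sumE : \sum_(y <- nb x) (M ^ L - a y) + \sum_(y <- nb x) a y = deg x * M ^ L.
  rewrite -big_split /= (eq_bigr (fun=> M ^ L)) => [|y _]; last by rewrite subnK.
  by rewrite big_const_seq count_predT iter_addn_0 mulnC.
have afx : a (f x) = M * a x.
  by rewrite /a -expnS; congr (_ ^ _); have := dL _ xs; lia.
have sum_a : deg x * a x < \sum_(y <- nb x) a y.
  rewrite (bigD1_seq (f x))//= afx.
  have a0 : 0 < a x by rewrite expn_gt0.
  have : (deg x).+1 * a x <= M * a x by rewrite leq_mul2r ltnS degB ?orbT.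
  by rewrite mulSn; move: (\sum_(y <- _ | _) _) (deg x * _) (M * _) => *; lia.
rewrite mulnBr; move: sumE sum_a.
have := leq_mul (leqnn (deg x)) (aM x).
move: (deg x * a x) (deg x * M ^ L) (\sum_(y <- nb x) a y) (\sum_(y <- nb x) _).
by move=> *; lia.
Qed.

Lemma stabilizes_exists eta : supported eta -> exists zeta, stabilizes eta zeta.
Proof.
have [h [h0 hs]] := exists_weight.
have [N] := ubnP (\sum_(y <- s) h y * eta y); elim: N eta => // N IH eta leN supp.
have [/hasP[x xs dx]|/hasPn H] := boolP (has (fun x => deg x <= eta x) s); last first.
  exists eta; split; first exact: rtc_refl.
  by apply/stableP; split=> // x /H; rewrite -ltnNge.
have t : topple eta (toppled x eta) by apply/toppleP; exists x; rewrite ?xs.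
have [||zeta [tz sz]] := IH (toppled x eta).
- have := toppled_weight h0 xs dx; have := hs _ xs; move: leN.
  move: (deg x * h x) (\sum_(y <- nb x) h y) (\sum_(y <- s) _) (\sum_(y <- s) _).
  by move=> *; lia.
- exact: toppled_supported.
by exists zeta; split=> //; exact: rtc_step tz.
Qed.

(** The particles of [p] are added one by one with a stabilization after each; by confluence the
    result is the same as when all are added at once. *)
Lemma sandpile_steps_add p xi zeta : stable xi -> stable zeta -> supported p ->
  rtc topple (fun x => xi x + p x) zeta -> rtc sandpile_step xi zeta.
Proof.
have [N] := ubnP (\sum_(y <- s) p y); elim: N p xi => // N IH p xi leN sxi sz p0 t.
have [/hasP[x xs px]|/hasPn un] := boolP (has (fun x => 0 < p x) s); last first.
  have pz y : p y = 0.
    have [/un|ys] := boolP (y \in s); first by rewrite lt0n negbK => /eqP.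
    by move/supportedP: p0 => ->.
  have E : (fun x => xi x + p x) = xi by apply/funext => y; rewrite pz addn0.
  rewrite E in t; case: t sxi {E leN} => [*|a b c /stable_no_topple F _ /F//].
  exact: rtc_refl.
pose p' y := p y - (y == x).
have [|xi' [t' sxi']] := @stabilizes_exists (add_particle x xi).
  apply/supportedP => y ys; rewrite /add_particle; case: eqP ys => [->|_ ys].
    by rewrite xs.
  by case: sxi => /supportedP->.
have st : sandpile_step xi xi' by split=> //; exists x; split=> //; exact/Ws.
apply: (rtc_step st).
apply: (IH p') => //.
- rewrite ltnS in leN; apply: leq_trans leN.
  rewrite [X in _ < X](bigD1_seq x)//= (bigD1_seq x)//= -addSn leq_add//.
    by rewrite /p' eqxx subn1 prednK.
  by apply: leq_sum => y yx; rewrite /p' (negbTE yx) subn0.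
- by move=> y ys; rewrite /p' p0.
apply: (topple_confluent sz t).
have := rtc_topple_add p' t'; congr (rtc _ _ _); apply/funext => y.
by rewrite /add_particle /p'; case: eqP => [->|_]; lia.
Qed.

Definition maximal_conf x := if x \in s then (deg x).-1 else 0.

Let deg_gt0 x : x \in s -> 0 < deg x.
Proof. by move=> /Ws/(rt.2 x)[+ _]; rewrite /Defs.deg; case: (nb x). Qed.

Lemma maximal_conf_stable : stable maximal_conf.
Proof.
apply/stableP; split=> [|x xs]; last by rewrite /maximal_conf xs prednK ?deg_gt0.
by apply/supportedP => x xs; rewrite /maximal_conf (negbTE xs).
Qed.

(** The vertex of [A] nearest to the sink has its next vertex outside [A]. *)
Lemma maximal_conf_allowed : allowed W maximal_conf.
Proof.
move=> A AW /prop_argmin-/(_ d)[x Ax minx]; exists x => //.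
have /Ws xs := AW _ Ax; have [fx dx] := rt.2 x (AW _ Ax).
have Afx : ~~ A (f x) by apply/negP => /minx; rewrite dx ltnn.
have : 0 < count (predC A) (nb x) by rewrite -has_count; apply/hasP; exists (f x).
rewrite /maximal_conf xs /Defs.deg -(count_predC A (nb x)).
by move: (count _ _) (count _ _) => *; lia.
Qed.

Lemma reach_maximal_conf eta : stable eta -> rtc sandpile_step eta maximal_conf.
Proof.
move=> seta; have /stableP[/supportedP e0 est] := seta.
apply: (@sandpile_steps_add (fun x => maximal_conf x - eta x)) => //.
- exact: maximal_conf_stable.
- by apply/supportedP => x xs; rewrite /maximal_conf (negbTE xs).
rewrite (_ : (fun x => _) = maximal_conf); first exact: rtc_refl.
apply/funext => x; rewrite /maximal_conf; case: ifP => [/est|/negbT/e0->//].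
by lia.
Qed.

Lemma allowed_add (eta : V -> nat) x : allowed W eta -> allowed W (add_particle x eta).
Proof.
move=> alw A AW /(alw A AW)[y Ay le]; exists y => //; apply: (leq_trans le).
by rewrite /add_particle; case: eqP.
Qed.

(** A recurrent configuration is reached back from [maximal_conf], and the chain preserves
    [allowed]. Conversely an allowed one must be reached from [maximal_conf], by adding particles
    and then toppling down with [burn_down]. *)
Lemma recurrentP eta : recurrent eta <-> stable eta /\ allowed W eta.
Proof.
split=> [[st rec]|[st alw]]; split=> //.
  have := rec _ (reach_maximal_conf st).
  apply: rtc_ind_inv maximal_conf_allowed => a b alw [_ [x [_ [t _]]]].
  by apply: rtc_ind_inv (allowed_add _ alw) t => a' b'; exact: allowed_topple.
move=> zeta ez; have sz : stable zeta.
  by apply: rtc_ind_inv st ez => a b _ [_ [x [_ []]]].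
apply: rtc_trans (reach_maximal_conf sz) _.
have [h [h0 hs]] := exists_weight; have [B degB] := seq_bound deg s.
(* [c] is [eta] with [u x] topplings at each [x] undone; the factor [B] makes it dominate
   [maximal_conf]. *)
pose u y := B * h y.
pose c x := eta x + deg x * u x - \sum_(y <- nb x) u y.
have sumu x : \sum_(y <- nb x) u y = B * \sum_(y <- nb x) h y.
  by rewrite big_distrr.
have cE x : x \in s -> B + \sum_(y <- nb x) u y <= deg x * u x.
  move=> xs; rewrite sumu mulnCA -mulnS leq_mul2l; apply/orP; right; exact: hs.
have /stableP[e0 est] := st.
apply: (@sandpile_steps_add (fun x => if x \in s then c x - maximal_conf x else 0)) => //.
- exact: maximal_conf_stable.
- by apply/supportedP => x /negbTE->.
apply: (@burn_down _ u) => //.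
- by move=> y ys; rewrite /u h0// muln0.
- by apply/supportedP => x xs; rewrite /maximal_conf (negbTE xs).
move=> x xs; have := cE _ xs; have := degB _ xs; rewrite /maximal_conf xs /c.
by move: (\sum_(y <- _) _) (deg x * _) => *; lia.
Qed.

End Recurrent.
End Sandpile.
End Graph.

(** * The burning bijection *)

Section Burning.
Variables (V : countType) (nb : V -> seq V).
Hypothesis simp : simple_graph nb.
Notation deg := (deg nb).
Notation rooted := (rooted nb).
Let nb_uniq x : uniq (nb x). Proof. by case: simp. Qed.
Let nb_sym x y : (x \in nb y) = (y \in nb x).
Proof. by case: simp => _ /(_ y x). Qed.
Let nb_irr x : x \in nb x = false.
Proof. by case: simp => _ _ /(_ x)/negbTE. Qed.

Definition level (d : V -> nat) (x : V) := [seq y <- nb x | (d y).+1 == d x].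

(* Majumdar-Dhar: [d] is the burning time, and among the neighbours burnt just
   before [x] the next vertex on the path to the sink encodes the height. *)
Definition conf (d : V -> nat) (f : V -> V) (x : V) : nat :=
  if d x == 0 then 0
  else count (fun y => d x <= d y) (nb x)
       + index (f x) (level d x).

Lemma rooted_gt0 W d f x : rooted W d f -> 0 < d x <-> W x.
Proof.
move=> rt; split=> [|/(rt.2 x)[_ ->]//].
by apply: contraPP => /(rt.1 x)[->].
Qed.

Lemma rooted_next_mem W d f x : rooted W d f -> W x -> f x \in level d x.
Proof. by move=> rt /(rt.2 x)[fx dx]; rewrite mem_filter fx dx eqxx. Qed.

Lemma count_level d x : 0 < d x ->
  count (fun y => d x <= d y) (nb x) + size (level d x) =
  count (fun y => (d x).-1 <= d y) (nb x).
Proof.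
move=> dx; rewrite size_filter -count_predUI addnC [X in X + _](_ : _ = 0).
  by apply: eq_count => y /=; lia.
by rewrite -(count_pred0 (nb x)); apply: eq_count => y /=; lia.
Qed.

(** Together with [conf_ge]: the height is too small for [x] to burn one step earlier, and large
    enough for it to burn at time [d x]. *)
Lemma conf_lt W d f x : rooted W d f -> W x ->
  conf d f x < count (fun y => (d x).-1 <= d y) (nb x).
Proof.
move=> rt Wx; have d0 := proj2 (rooted_gt0 x rt) Wx.
by rewrite -count_level// /conf gtn_eqF// ltn_add2l index_mem (rooted_next_mem rt).
Qed.

Lemma conf_ge W d f x : rooted W d f -> W x ->
  count (fun y => d x <= d y) (nb x) <= conf d f x.
Proof.
move=> rt Wx; have d0 := proj2 (rooted_gt0 x rt) Wx.
by rewrite /conf gtn_eqF// leq_addr.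
Qed.

Lemma conf_out W d f x : rooted W d f -> ~ W x -> conf d f x = 0.
Proof. by move=> rt Wx; rewrite /conf (rt.1 x Wx).1. Qed.

Lemma conf_lt_deg W d f x : rooted W d f -> W x -> conf d f x < deg x.
Proof. by move=> rt /(conf_lt rt)/leq_trans; apply; exact: count_size. Qed.

Lemma conf_allowed W d f : rooted W d f -> allowed nb W (conf d f).
Proof.
move=> rt A AW /prop_argmin-/(_ d)[x Ax minx]; exists x => //.
by apply: leq_trans (conf_ge rt (AW _ Ax)); apply: sub_count => y /minx.
Qed.

(** By induction on [t] the sets burnt before time [t] agree, since at a vertex burnt later for one
    pair [conf_ge] and [conf_lt] contradict each other. Equal burning times give equal levels, and
    the index in the level recovers [f]. *)
Lemma conf_inj W d f d' f' : rooted W d f -> rooted W d' f' ->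
  conf d f = conf d' f' -> d = d' /\ f = f'.
Proof.
move=> rt rt' E.
have half dd ff dd' ff' t x : rooted W dd ff -> rooted W dd' ff' ->
    conf dd ff = conf dd' ff' ->
    (forall y, dd y < t <-> dd' y < t) -> dd x = t -> dd' x <= t.
  move=> r r' e lt_t dx; rewrite leqNgt; apply/negP => tx.
  have Wx : W x by apply/(rooted_gt0 x r'); lia.
  have := conf_lt r' Wx; rewrite -e; apply/negP; rewrite -leqNgt.
  apply: leq_trans (conf_ge r Wx); apply: sub_count => y /= ty.
  rewrite dx leqNgt; apply/negP => /lt_t.
  by lia.
have lev t : forall x, d x < t <-> d' x < t.
  elim: t => // t IH x; rewrite !ltnS; split=> le.
    have [/IH/ltnW//|tx] := ltnP (d x) t.
    by apply: (half d f d' f' t x) => //; lia.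
  have [/IH/ltnW//|tx] := ltnP (d' x) t.
  by apply: (half d' f' d f t x) => //; [move=> y; split=> /IH|lia].
have dd' : d = d'.
  apply/funext => x; have := lev (d x).+1 x; have := lev (d' x).+1 x.
  by rewrite !ltnSn => -[_ /(_ isT) le1] [/(_ isT) le2 _]; lia.
split=> //; apply/funext => x; have [Wx|Wx] := pselect (W x); last first.
  by rewrite (rt.1 x Wx).2 (rt'.1 x Wx).2.
have /= := congr1 (@^~ x) E; rewrite /conf -dd' gtn_eqF ?(rooted_gt0 x rt)//.
move=> /addnI ei; have fx := rooted_next_mem rt Wx.
have f'x := rooted_next_mem rt' Wx; rewrite -dd' in f'x.
by rewrite -(nth_index x fx) ei nth_index.
Qed.

(** The burning algorithm is run on [eta]: [allowed] makes each nonempty unburnt set shrink, so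
    everything burns within [size s] steps, and [d] is the burning time. *)
Lemma conf_surj (W : set V) eta : (forall x, ~ W x -> eta x = 0) ->
  (forall x, W x -> eta x < deg x) -> finite_set W -> allowed nb W eta ->
  exists d f, rooted W d f /\ conf d f = eta.
Proof.
move=> e0 st finW alw; have [s us Ws] := finite_set_enum finW.
(* [A t] is the set of vertices still unburnt at time [t] *)
pose step (A : pred V) : pred V := [pred x | A x && (eta x < count A (nb x))].
pose A t : pred V := iter t step (mem s).
have AS t x : A t.+1 x = A t x && (eta x < count (A t) (nb x)) by [].
have Adecr t t' x : t <= t' -> A t' x -> A t x.
  by move=> /subnK <-; elim: (t' - t) => [//|k IH]; rewrite addSn AS => /andP[/IH].
have Asub t x : A t x -> x \in s by exact: (@Adecr 0).
have size_A t : count (A t) s <= size s - t.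
  elim: t => [|t IH]; first by rewrite subn0 count_size.
  have subA : subpred (A t.+1) (A t) by move=> y; exact: Adecr.
  have [/hasP[x0 _ x0A]|] := boolP (has (A t) s); last first.
    rewrite has_count -leqNgt leqn0 => /eqP e; rewrite (leq_trans _ (leq0n _))// -e.
    exact: sub_count.
  have [||x Ax cx] := alw (A t); [by move=> x /Asub/Ws|by exists x0|].
  have : count (A t.+1) s < count (A t) s.
    rewrite (count_remove (A t) x us) Ax (Asub _ _ Ax) addn1 ltnS.
    apply: sub_count => y AS1y; have /andP[Ay lt] : step (A t) y by [].
    apply/andP; split; first exact: Ay.
    by apply: contraTneq lt => ->; rewrite -leqNgt.
  by lia.
have Aout x : exists t, ~~ A t x.
  exists (size s); apply/negP => Ax; have := size_A (size s); rewrite subnn leqn0.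
  by rewrite -leqn0 leqNgt -has_count => /hasP; apply; exists x; rewrite ?(Asub _ _ Ax).
pose d x := ex_minn (Aout x).
have dA t x : A t x = (t < d x).
  rewrite /d; case: ex_minnP => m nAm minm; apply/idP/idP => [At|tm].
    by rewrite ltnNge; apply/negP => mt; case/negP: nAm; exact: Adecr At.
  by apply: contraLR tm => /minm; rewrite -leqNgt.
have d0 x : W x -> 0 < d x by rewrite -dA => /Ws.
have dout x : ~ W x -> d x = 0.
  by move=> Wx; apply/eqP; rewrite -leqn0 leqNgt -dA; apply/negP => /Ws.
have lo x : W x -> count (fun y => d x <= d y) (nb x) <= eta x.
  move=> /d0 dx; have : ~~ A (d x) x by rewrite dA ltnn.
  rewrite -(prednK dx) AS dA prednK// leqnn /= -leqNgt; apply: leq_trans.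
  by apply: sub_count => y /=; rewrite dA prednK.
(* At [d x = 1] all neighbours are counted and the bound is stability; otherwise it says that [x]
   survived the preceding step. *)
have hi x : W x -> eta x < count (fun y => (d x).-1 <= d y) (nb x).
  move=> Wx; have dx := d0 _ Wx; case: (ltnP 1 (d x)) => dx1; last first.
    rewrite (_ : (d x).-1 = 0); last by lia.
    by rewrite count_predT; exact: st.
  have : A (d x).-1 x by rewrite dA prednK.
  rewrite (_ : (d x).-1 = (d x).-2.+1); last by lia.
  rewrite AS => /andP[_ /leq_trans]; apply; apply: sub_count => y /=.
  by rewrite dA.
pose i x := eta x - count (fun y => d x <= d y) (nb x).
pose f x := if x \in s then nth x (level d x) (i x) else x.
have ilt x : W x -> i x < size (level d x).
  move=> Wx; have := lo _ Wx; have := hi _ Wx.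
  rewrite -(count_level (d0 _ Wx)) /i.
  by move: (size _) (count _ _) => *; lia.
have fE x : W x -> f x \in level d x.
  by move=> Wx; rewrite /f (proj1 (Ws x) Wx) mem_nth ?ilt.
exists d, f; split.
  split=> x Wx; last by move: (fE _ Wx); rewrite mem_filter => /andP[/eqP].
  by split; [exact: dout|rewrite /f ifF//; apply/negP => /Ws].
apply/funext => x; rewrite /conf; case: eqP => [dx|/eqP].
  by rewrite e0// => /d0; rewrite dx.
rewrite -lt0n => dx; have Wx : W x by apply: contraPP dx => /dout->.
rewrite /f (proj1 (Ws x) Wx) index_uniq ?ilt ?filter_uniq//.
by rewrite subnKC ?lo.
Qed.

(** * Oriented trees as sets of edges *)

Definition tree_of (f : V -> V) (e : edge nb) : bool :=
  (f (val e).1 == (val e).2) || (f (val e).2 == (val e).1).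

Definition ends (e : edge nb) (x y : V) : Prop := val e = (x, y) \/ val e = (y, x).

Lemma endsC e x y : ends e x y -> ends e y x.
Proof. by case; [right|left]. Qed.

Lemma ends_val e : ends e (val e).1 (val e).2.
Proof. by left; case: (val e). Qed.

Lemma edge_between x y : y \in nb x -> exists e : edge nb, ends e x y.
Proof.
move=> yx; have [xy|xy|xy] := ltngtP (pickle x) (pickle y).
- have H : adj nb (x, y).1 (x, y).2 && (pickle (x, y).1 < pickle (x, y).2).
    by rewrite /adj /= yx.
  by exists (exist _ (x, y) H); left.
- have H : adj nb (y, x).1 (y, x).2 && (pickle (y, x).1 < pickle (y, x).2).
    by rewrite /adj /= nb_sym yx.
  by exists (exist _ (y, x) H); right.
- by move: yx; rewrite (pcan_inj pickleK xy) nb_irr.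
Qed.

Lemma ends_inj e e' x y : ends e x y -> ends e' x y -> e = e'.
Proof.
move=> E E'; apply: val_inj; have := valP e; have := valP e'.
case: E => ->; case: E' => -> //= /andP[_ +] /andP[_]; lia.
Qed.

Lemma ends_neq e x y : ends e x y -> x != y.
Proof.
by move=> E; apply/eqP => xy; have := valP e; case: E => -> /=; rewrite xy ltnn andbF.
Qed.

Lemma ends_adj e x y : ends e x y -> y \in nb x.
Proof.
move=> E; have /andP[+ _] := valP e.
by case: E => -> //=; rewrite /adj // nb_sym.
Qed.

Lemma tree_of_ends f e x y : ends e x y -> tree_of f e = (f x == y) || (f y == x).
Proof. by rewrite /tree_of; case=> -> //=; rewrite orbC. Qed.

(* The inductive step: if [f x] and [f' x] differ then the edge from [x] to [f x]
   is traversed backwards by [f'], and so [f] runs back and forth along it. *)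
Lemma rooted_agree W W' d d' f f' (D : set V) : rooted W d f -> rooted W' d' f' ->
  D `<=` W ->
  (forall e x y, ends e x y -> D x -> tree_of f e = tree_of f' e) ->
  (forall x, D x -> ~ D (f x) -> f' x = f x) -> forall x, D x -> f x = f' x.
Proof.
move=> rt rt' DW agree bnd x; have [N] := ubnP (d x); elim: N x => // N IH x leN Dx.
have [Dfx|] := pselect (D (f x)); last by move=> /(bnd x Dx).
have [fx dx] := rt.2 x (DW _ Dx); have [e exy] := edge_between fx.
have := agree e _ _ exy Dx; rewrite !(tree_of_ends _ exy) eqxx => /esym/orP[/eqP//|].
rewrite -(IH (f x))//; last by lia.
by move=> /eqP ffx; have := (rt.2 _ (DW _ Dfx)).2; rewrite ffx; lia.
Qed.

Lemma rooted_exit W d f (D : set V) x : rooted W d f -> D `<=` W -> D x ->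
  exists2 y, D y & ~ D (f y).
Proof.
move=> rt DW; have [N] := ubnP (d x); elim: N x => // N IH x leN Dx.
have [Dfx|nDfx] := pselect (D (f x)); last by exists x.
by apply: IH Dfx; have := (rt.2 _ (DW _ Dx)).2; lia.
Qed.

(** * Spanning trees and recurrent configurations of the wired graph *)

Section Wired.
Variables (Vn : nat -> set V) (n : nat).
Notation W := (Vn n).
Notation wedge := (wedge Vn n).
Notation wconn := (wconn Vn n).
Notation wire := (wire Vn n).

Lemma wire_in x : W x -> wire x = Some x.
Proof. by rewrite /Defs.wire; case: pselect. Qed.

Lemma wire_out x : ~ W x -> wire x = None.
Proof. by rewrite /Defs.wire; case: pselect. Qed.

Lemma wire_Some x y : wire x = Some y -> x = y /\ W x.
Proof. by rewrite /Defs.wire; case: pselect => // Wx [<-]. Qed.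

Lemma wedgeP (T : edge nb -> bool) a b : wedge T a b <->
  exists e x y, [/\ ends e x y, T e, W x \/ W y, wire x = a & wire y = b].
Proof.
split=> [[e [Te We E]]|[e [x [y [exy Te We <- <-]]]]].
  case: E => -[? ?].
    by exists e, (val e).1, (val e).2; split=> //; exact: ends_val.
  exists e, (val e).2, (val e).1; split=> //; first exact/endsC/ends_val.
  by case: We; [right|left].
exists e; split=> //; rewrite /in_Gn; case: exy => -> /=; [done|tauto|by left|by right].
Qed.

Lemma wconn_refl (T : edge nb -> bool) a : wconn T a a.
Proof. by exists 0, (fun=> a). Qed.

Lemma wconn_step (T : edge nb -> bool) a b c :
  wedge T a b -> wconn T b c -> wconn T a c.
Proof.
move=> ab [k [p [p0 pk H]]]; exists k.+1, (fun i => if i is j.+1 then p j else a).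
split=> // -[|i] ik; first by rewrite p0.
exact: H.
Qed.

Lemma wconn_ind (T : edge nb -> bool) (P : option V -> Prop) a b :
  (forall u v, P u -> wedge T u v -> P v) -> P a -> wconn T a b -> P b.
Proof.
move=> HP Pa [k [p [p0 <- H]]]; have : forall i, i <= k -> P (p i).
  elim=> [|i IH] ik; first by rewrite p0.
  by apply: HP (H i ik); exact/IH/ltnW.
exact.
Qed.

Lemma wconnected_sub (T T' : edge nb -> bool) : (forall e, T e -> T' e) ->
  wconnected Vn n T -> wconnected Vn n T'.
Proof.
move=> sub H x /H [k [p [p0 pk E]]]; exists k, p; split=> // i /E.
by move=> [e [/sub Te We ?]]; exists e.
Qed.

Lemma rooted_wconnected d f : rooted W d f -> wconnected Vn n (tree_of f).
Proof.
move=> rt x Wx; rewrite -(wire_in Wx).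
have [N] := ubnP (d x); elim: N x {Wx} => // N IH x leN.
have [Wx|/wire_out->] := pselect (W x); last exact: wconn_refl.
have [fx dx] := rt.2 x Wx; have [e exy] := edge_between fx.
apply: (@wconn_step _ _ (wire (f x))); last by apply: IH; lia.
apply/wedgeP; exists e, x, (f x); split=> //; last by left.
by rewrite (tree_of_ends _ exy) eqxx.
Qed.

Lemma rooted_spanning_tree d f : rooted W d f -> spanning_tree Vn n (tree_of f).
Proof.
move=> rt.
have key x y e : ends e x y -> f x = y -> W x.
  by move=> /ends_neq/eqP xy fxy; apply: contrapT => /(rt.1 x)[_]; rewrite fxy => /esym.
split.
- move=> e /orP[] /eqP H; [left|right]; apply: key H; first exact: ends_val.
  exact/endsC/ends_val.
- exact: rooted_wconnected rt.
move=> e Te wc.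
have [x [exy Wx]] : exists x, ends e x (f x) /\ W x.
  move: Te => /orP[] /eqP H; have E := ends_val e.
    by exists (val e).1; rewrite H; split=> //; exact: (key _ _ _ E H).
  by exists (val e).2; rewrite H; split; [exact: endsC|exact: (key _ _ _ (endsC E) H)].
(* [P] marks the vertices whose path to the sink passes through [x]. Without the edge from [x] to
   [f x] no tree edge leaves them, and the sink is not among them. *)
pose P (a : option V) := exists k v, a = Some v /\ iter k f v = x.
suff : P None by move=> [? [? []]].
have out k v : ~ W v -> iter k f v = v.
  by move=> Wv; elim: k => //= k ->; exact: (rt.1 v Wv).2.
have wireP k v : iter k f v = x -> P (wire v).
  move=> kx; have Wv : W v.
    by apply: contrapT => Wv; apply: (Wv); rewrite -(out k v Wv) kx.
  exists k, v; split=> //; exact: wire_in.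
apply: wconn_ind (wc x Wx); last by exists 0, x.
move=> u _ [k [v [-> kx]]] /wedgeP[e' [v' [y [ev' /andP[Te' /eqP ee'] _ E <-]]]].
have {E}[? Wv] := wire_Some E; subst v'.
move: Te'; rewrite (tree_of_ends _ ev') => /orP[] /eqP fv; last first.
  by apply: (wireP k.+1); rewrite iterSr fv.
case: k kx => [/= vx|k]; last by rewrite iterSr fv => /wireP.
by case: ee'; apply: ends_inj ev' _; rewrite -fv vx.
Qed.

(** Breadth-first search from the sink: [near k a] says that [a] reaches the sink in [k] steps of
    [T], [d] is the least such [k], and [f] takes the first step of a shortest walk. *)
Lemma wconnected_rooted T : wconnected Vn n T ->
  exists d f, rooted W d f /\ forall e, tree_of f e -> T e.
Proof.
move=> wc.
pose near := fix near (k : nat) (a : option V) {struct k} : Prop :=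
  if k is j.+1 then exists2 b, wedge T a b & near j b else a = None.
have nearE x : exists k, `[< near k (wire x) >].
  have [/[dup] Wx /wc|/wire_out->] := pselect (W x); last by exists 0; exact/asboolP.
  rewrite -(wire_in Wx) => -[k [p [<- pk H]]]; exists k; apply/asboolP.
  elim: k p pk H => // k IH p pk H; exists (p 1); first exact: H.
  by apply: (IH (fun i => p i.+1)) => // i ik; exact: (H i.+1).
pose d x := ex_minn (nearE x).
have dP x : near (d x) (wire x) /\ forall k, near k (wire x) -> d x <= k.
  by rewrite /d; case: ex_minnP => m /asboolP ? H; split=> // k ?; apply/H/asboolP.
have next x : exists y, (~ W x -> y = x) /\
    (W x -> (exists2 e, ends e x y & T e) /\ d x = (d y).+1).
  have [Wx|Wx] := pselect (W x); last by exists x; split.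
  have [+ minx] := dP x; case dx : (d x) => [|k]; first by rewrite /= wire_in.
  move=> [b /wedgeP[e [x' [y [exy Te _ E <-]]]] ky].
  rewrite (wire_in Wx) in E; have [? _] := wire_Some E; subst x'.
  exists y; split=> // _; split; first by exists e.
  have [ny miny] := dP y; have le := miny _ ky.
  have : d x <= (d y).+1; last by lia.
  apply: minx; exists (wire y) => //; apply/wedgeP; exists e, x, y; split=> //.
  by left.
have [f fP] := choice next.
have rt : rooted W d f.
  split=> x Wx; last by have [[e /ends_adj]] := (fP x).2 Wx.
  split; last exact: (fP x).1.
  by apply/eqP; rewrite -leqn0; apply: (dP x).2; rewrite wire_out.
exists d, f; split=> // e.
have key x y : ends e x y -> f x = y -> T e.
  move=> exy fxy; have Wx : W x.
    apply: contrapT => /(fP x).1; rewrite fxy => yx.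
    by have := ends_neq exy; rewrite yx eqxx.
  by have [[e' + Te'] _] := (fP x).2 Wx; rewrite fxy => /(ends_inj exy)->.
move=> /orP[] /eqP; apply: key; first exact: ends_val.
exact/endsC/ends_val.
Qed.

(** The breadth-first tree inside [T] is already connected, so by minimality [T] has no further
    edge. *)
Lemma spanning_treeP T : spanning_tree Vn n T <->
  exists d f, rooted W d f /\ T = tree_of f.
Proof.
split=> [[inG wc minT]|[d [f [rt ->]]]]; last exact: rooted_spanning_tree rt.
have [d [f [rt sub]]] := wconnected_rooted wc.
exists d, f; split=> //; apply/funext => e; apply/idP/idP => [Te|/sub//].
apply: contrapT => /negP nte; apply: (minT e Te).
apply: wconnected_sub (rooted_wconnected rt) => e' te'.
by rewrite sub//=; apply: contraNneq nte => <-.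
Qed.

Lemma tree_of_inj d d' f f' : rooted W d f -> rooted W d' f' ->
  tree_of f = tree_of f' -> d = d' /\ f = f'.
Proof.
move=> rt rt' E; have ff' : f = f'.
  apply/funext => x; have [Wx|Wx] := pselect (W x); last first.
    by rewrite (rt.1 x Wx).2 (rt'.1 x Wx).2.
  apply: (@rooted_agree W W d d' f f' W) => // [e ? ? _ _|{Wx}x Wx Wfx]; first by rewrite E.
  have [fx _] := rt.2 x Wx; have [e exy] := edge_between fx.
  have : tree_of f' e by rewrite -E (tree_of_ends _ exy) eqxx.
  rewrite (tree_of_ends _ exy) => /orP[/eqP//|/eqP].
  rewrite (rt'.1 _ Wfx).2 => fxx.
  by case: Wfx; rewrite fxx.
split=> //; apply/funext => x.
have [N] := ubnP (d x); elim: N x => // N IH x leN.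
have [Wx|Wx] := pselect (W x); last by rewrite (rt.1 x Wx).1 (rt'.1 x Wx).1.
have [_ dx] := rt.2 x Wx; have [_ ->] := rt'.2 x Wx.
by rewrite dx -ff' IH//; lia.
Qed.

Lemma exists_rooted : connected_graph nb -> infinite_set [set: V] ->
  finite_set W -> exists d f, rooted W d f.
Proof.
move=> conn inf fin; suff /wconnected_rooted[d [f [rt _]]] :
  wconnected Vn n (fun _ : edge nb => true) by exists d, f.
have [y Wy] : exists y, ~ W y.
  apply: contrapT => /forallNP H; apply: inf; apply: sub_finite_set fin.
  by move=> y _; apply: contrapT; exact: H.
move=> x Wx; rewrite -(wire_in Wx) -(wire_out Wy).
have [p [+ <-]] := conn x y; elim: p x {Wx} => [|z p IH] x /=.
  by move=> _; exact: wconn_refl.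
move=> /andP[xz /IH wz].
(* A step between two vertices outside [W] would be a loop at the sink, which is no edge; both ends
   already are the sink. *)
have [Wxz|/not_orP[Wx Wz]] := pselect (W x \/ W z); last first.
  by rewrite (wire_out Wx) -(wire_out Wz).
apply: wconn_step wz; apply/wedgeP.
by have [e exz] := edge_between xz; exists e, x, z; split.
Qed.

Lemma recurrent_conf : connected_graph nb -> infinite_set [set: V] ->
  finite_set W -> forall eta,
  recurrent nb Vn n eta <-> exists d f, rooted W d f /\ eta = conf d f.
Proof.
move=> conn inf fin eta; have [s us Ws] := finite_set_enum fin.
have [d0 [f0 rt0]] := exists_rooted conn inf fin.
rewrite (recurrentP simp us Ws rt0); split=> [[[e0 est] alw]|[d [f [rt ->]]]].
  by have [d [f [rt <-]]] := conf_surj e0 est fin alw; exists d, f.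
split; last exact: conf_allowed rt.
by split=> x Wx; [exact: conf_out rt Wx|exact: conf_lt_deg rt Wx].
Qed.

End Wired.


(* If only one edge of the tree leaves [D], then [D] contains the whole path in
   the tree between any two of its points, so [d] is determined on [D] up to a
   constant and [conf] is determined at the points having all neighbours in [D]. *)
Lemma conf_agree W W' d d' f f' (D : set V) z z' x :
  rooted W d f -> rooted W' d' f' -> D `<=` W -> D `<=` W' ->
  (forall e x y, ends e x y -> D x -> tree_of f e = tree_of f' e) ->
  (forall e x y, ends e x y -> D x -> ~ D y -> tree_of f e -> x = z /\ y = z') ->
  D x -> (forall y, y \in nb x -> D y) -> conf d f x = conf d' f' x.
Proof.
move=> rt rt' DW DW' agree cross Dx Dnb.
have exitE x0 : D x0 -> ~ D (f x0) -> x0 = z /\ f x0 = z'.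
  move=> Dx0 nDf; have [fx0 _] := rt.2 _ (DW _ Dx0).
  have [e exy] := edge_between fx0; apply: (cross _ _ _ exy) => //.
  by rewrite (tree_of_ends _ exy) eqxx.
have exitE' x0 : D x0 -> ~ D (f' x0) -> x0 = z /\ f' x0 = z'.
  move=> Dx0 nDf; have [fx0 _] := rt'.2 _ (DW' _ Dx0).
  have [e exy] := edge_between fx0; apply: (cross _ _ _ exy) => //.
  by rewrite (agree _ _ _ exy)// (tree_of_ends _ exy) eqxx.
have [y' Dy' nDy'] := rooted_exit rt' DW' Dx.
have f'z : f' z = z' by have [<- ->] := exitE' _ Dy' nDy'.
have ff' : forall x, D x -> f x = f' x.
  apply: (rooted_agree rt rt' DW) => // x0 Dx0 nDf.
  by have [-> ->] := exitE _ Dx0 nDf.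
(* On [D] the two distances differ by the constant by which they differ at the exit point [z']. *)
have dE y : D y -> d y + d' z' = d' y + d z'.
  have [N] := ubnP (d y); elim: N y => // N IH y leN Dy.
  have [_ dy] := rt.2 _ (DW _ Dy); have [_ d'y] := rt'.2 _ (DW' _ Dy).
  have [Df|nDf] := pselect (D (f y)).
    by have := IH (f y); rewrite d'y dy -ff'// => /(_ _ Df); lia.
  by have [_ fy] := exitE _ Dy nDf; rewrite d'y dy -ff'// fy; lia.
have d0 := proj2 (rooted_gt0 x rt) (DW _ Dx).
have d'0 := proj2 (rooted_gt0 x rt') (DW' _ Dx).
have dx := dE _ Dx.
rewrite /conf !gtn_eqF// (ff' _ Dx); congr (_ + _).
  by apply: eq_in_count => y /Dnb/dE; lia.
congr (index _ _); apply: eq_in_filter => y /Dnb/dE dy.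
by lia.
Qed.

End Burning.

(** * Finite cuts of a one-ended tree *)

Lemma koenig (V : choiceType) (nb : V -> seq V) (r : rel V) (x : V) :
  (forall a b, r a b -> b \in nb a) ->
  infinite_set [set y | exists2 s, path r x s & last x s = y] ->
  exists p : nat -> V, [/\ p 0 = x, injective p & forall i, r (p i) (p i.+1)].
Proof.
move=> rnb inf.
(* [R s] collects the ends of the simple paths from [x] which extend [s]; a path
   is kept as long as it has infinitely many extensions. *)
pose R s := [set y | exists t, [/\ path r x (s ++ t), uniq (x :: s ++ t)
                                 & last x (s ++ t) = y]].
have inf0 : infinite_set (R [::]).
  move=> fin; apply: inf; apply: sub_finite_set fin => y [s ps <-] /=.
  by have [s' ps' us' _] := shortenP ps; exists s'.
have next s : exists v, infinite_set (R s) -> infinite_set (R (rcons s v)).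
  apply: contrapT => /forallNP H; have infs : infinite_set (R s).
    by apply: contrapT => ninf; apply: (H (last x s)).
  have {}H v : finite_set (R (rcons s v)).
    by apply: contrapT => Hv; apply: (H v).
  (* The ends extending [s] are [last x s] itself and those continuing through one of its finitely
     many neighbours; if each continuation had finitely many ends, so would [s]. *)
  apply: infs.
  apply: (@sub_finite_set _ _ ([set last x s] `|`
           \bigcup_(v in [set` nb (last x s)]) R (rcons s v))).
    move=> y [[|v t] [pt ut <-]]; first by left; rewrite cats0.
    right; exists v; last by exists t; rewrite cat_rcons; split.
    by move: pt; rewrite cat_path /= => /and3P[_ /rnb].
  rewrite finite_setU; split; first exact: finite_set1.
  by apply: bigcup_finite => //; exact: finite_seq.
have [f fP] := choice next.
pose S k := iter k (fun s => rcons s (f s)) [::].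
have SE k : S k.+1 = rcons (S k) (f (S k)) by [].
have infS k : infinite_set (R (S k)) by elim: k => // k /fP.
have SP k : path r x (S k) /\ uniq (x :: S k).
  have [y [t [pt ut _]]] : R (S k) !=set0.
    by apply: contrapT => /nonemptyPn e; apply: (infS k); rewrite e.
  move: pt ut; rewrite cat_path -cat_cons cat_uniq => /andP[? _] /andP[? _].
  by split.
have mem i j : i <= j -> last x (S i) \in x :: S j.
  move=> /subnK <-; elim: (j - i) => [|k IH]; first exact: mem_last.
  by rewrite addSn SE -rcons_cons mem_rcons inE IH orbT.
have neq i j : i < j -> last x (S i) <> last x (S j).
  case: j => // j; rewrite ltnS => /mem im; rewrite SE last_rcons => E.
  by have [_] := SP j.+1; rewrite SE -rcons_cons rcons_uniq -E im.
exists (fun k => last x (S k)); split=> //.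
  by move=> i j E; have [/neq/(_ E)|/neq/(_ (esym E))|] := ltngtP i j.
by move=> i; have [+ _] := SP i.+1; rewrite SE rcons_path last_rcons => /andP[].
Qed.

Lemma injective_eventually_notin (T : eqType) (p : nat -> T) (s : seq T) :
  injective p -> exists I, forall i, I <= i -> p i \notin s.
Proof.
move=> inj; elim: s => [|a s [I IH]]; first by exists 0.
have [[k ka]|ne] := pselect (exists k, p k = a).
  exists (maxn I k.+1) => i; rewrite geq_max inE negb_or => /andP[/IH-> ki].
  by rewrite andbT -ka; apply/eqP => /inj; lia.
exists I => i /IH si; rewrite inE negb_or si andbT.
by apply/eqP => ia; apply: ne; exists i.
Qed.

Section OneEnded.
Variables (V : countType) (nb : V -> seq V).
Hypothesis simp : simple_graph nb.
Hypothesis inf : infinite_set [set: V].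
Variable w : edge nb -> bool.
Hypothesis wtree : one_ended_spanning_tree w.

Let g x y := `[< open_edge w x y >].

Let gnb x y : g x y -> y \in nb x.
Proof. by move=> /asboolP[e [_ E]]; exact: ends_adj E. Qed.

Let gsym x y : g x y = g y x.
Proof.
by apply/asboolP/asboolP => -[e [we [E|E]]]; exists e; split=> //; [right|left|right|left].
Qed.

Let gconn x y : exists2 s, path g x s & last x s = y.
Proof.
have [conn _ _] := wtree; have [k [p [<- <- H]]] := conn x y.
elim: k p H => [|k IH] p H; first by exists [::].
have [|s ps ls] := IH (fun i => p i.+1); first by move=> i ik; exact: H.
by exists (p 1 :: s) => //=; rewrite ps andbT; apply/asboolP; exact: H.
Qed.

(* The ray to infinity crosses the edges [p i, p i.+1]; removing the i-th one
   splits the tree in two, and the part containing [p 0] is finite. *)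
Lemma exists_cut (K : seq V) : exists (D : set V) (z z' : V),
  [/\ finite_set D, forall x, x \in K -> D x &
    forall e x y, ends e x y -> D x -> ~ D y -> w e -> x = z /\ y = z'].
Proof.
have [_ acyc end1] := wtree.
have [x0 _] : [set: V] !=set0 by apply: contrapT => /nonemptyPn e; apply: inf; rewrite e.
have [p [p0 pinj pg]] : exists p : nat -> V,
    [/\ p 0 = x0, injective p & forall i, g (p i) (p i.+1)].
  apply: (koenig gnb); rewrite (_ : [set y | _] = setT)//.
  by apply/seteqP; split=> // y _; exact: gconn.
pose h i x y := g x y && ~~ ((x == p i) && (y == p i.+1) || (x == p i.+1) && (y == p i)).
have hg i x y : h i x y -> g x y by case/andP.
have hsym i x y : h i x y = h i y x.
  by rewrite /h gsym orbC ![_ && (_ == p i)]andbC ![_ && (_ == p i.+1)]andbC; do !case: (_ == _).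
pose D i := [set y | exists2 s, path (h i) (p i) s & last (p i) s = y].
have D0 i : D i (p i) by exists [::].
have Dh i x y : D i x -> h i x y -> D i y.
  move=> [s ps <-] sy; exists (rcons s y); last by rewrite last_rcons.
  by rewrite rcons_path ps.
(* A simple path joining the ends of the removed edge would close a cycle with it. *)
have nDS i : ~ D i (p i.+1).
  move=> [s0 ps0]; have [s ps us sub_s ls] := shortenP ps0.
  apply: acyc; exists (size s).+1, (fun k => nth (p i) (p i :: s) k).
  have s2 : 1 < size s.
    case: s ps ls {us sub_s} => [_ /=/pinj|a [|//]]; first by lia.
    by rewrite /= andbT => + e; rewrite e /h !eqxx /= andbF.
  split=> //.
  - by move=> a b ak bk /eqP; rewrite nth_uniq// => /eqP.
  - by move=> k; rewrite ltnS => ks; apply/asboolP/(hg i); exact: (pathP (p i) ps).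
  - rewrite (_ : nth _ _ _ = p i.+1); last by rewrite -ls; exact: (nth_last (p i) (p i :: s)).
    by have := pg i; rewrite gsym => /asboolP.
have hp i k : k != i -> h i (p k) (p k.+1).
  move=> ki; rewrite /h pg !(inj_eq pinj) eqSS (negbTE ki) /=.
  by apply/negP => /andP[/eqP->]; lia.
have nD i k : i < k -> ~ D i (p k).
  elim: k => // k IH; rewrite ltnS leq_eqVlt => /predU1P[<-//|ik] Dk.
  by apply: (IH ik); apply: Dh Dk _; rewrite hsym hp// gtn_eqF.
have Dp0 i : D i (p 0).
  suff H : forall k, k <= i -> D i (p (i - k)) by have := H i (leqnn i); rewrite subnn.
  move=> k.
  elim: k => [|k IH] ki; first by rewrite subn0.
  apply: (Dh _ (p (i - k))); first exact/IH/ltnW.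
  by rewrite hsym (_ : i - k = (i - k.+1).+1) ?hp//; lia.
(* An infinite [D i] would contain a ray, which by one-endedness meets [p] beyond [i], where [D i]
   has no vertex. *)
have finD i : finite_set (D i).
  apply: contrapT => /(koenig (fun a b ab => gnb (hg _ _ _ ab)))[q [q0 qinj qh]].
  have Dq k : D i (q k) by elim: k => [|k /Dh]; [rewrite q0|apply].
  have [||j [k [ij pq]]] := end1 p q _ _ i.+1.
  - by split=> // k; apply/asboolP; exact: pg.
  - by split=> // k; apply/asboolP; exact: hg (qh k).
  by apply: (nD i j ij); rewrite pq.
(* The finite path from [p 0] to [x] avoids [p i] for large [i], hence also the removed edge. *)
have big x : exists I, forall i, I <= i -> D i x.
  have [s ps ls] := gconn (p 0) x.
  have [I HI] := injective_eventually_notin (p 0 :: s) pinj.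
  exists I => i /HI; rewrite -ls.
  elim: s (p 0) ps (Dp0 i) {ls HI} => [//|b s IH] a /= /andP[ab pbs] Da.
  rewrite !inE !negb_or => /and3P[ia ib is_]; apply: (IH b) => //.
    by apply: Dh Da _; rewrite /h ab /= !(eq_sym _ (p i)) (negbTE ia) (negbTE ib) andbF.
  by rewrite inE negb_or ib.
have [i KD] : exists i, forall x, x \in K -> D i x.
  have [I IP] := choice big; have [B HB] := seq_bound I K.
  by exists B => x /HB/IP.
exists (D i), (p i), (p i.+1); split; [exact: finD|exact: KD|].
move=> e x y exy Dx nDy we.
have gxy : g x y by apply/asboolP; exists e.
apply: contrapT => ne; apply: (nDy); apply: Dh (Dx) _; rewrite /h gxy /=.
apply/negP => /orP[] /andP[/eqP ex /eqP ey]; first by apply: ne.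
by case: (nDS i); rewrite -ex.
Qed.

End OneEnded.

Local Open Scope ring_scope.

(** * Frequencies of events *)

(** Transports the counts of trees and of recurrent configurations to one and the same list of
    orientations. *)
Lemma fsum1_image (R : realType) (X Y : choiceType) (A : set X) (B : set Y)
    (g : X -> Y) (P : Y -> Prop) : finite_set A -> set_inj A g ->
    (forall y, B y <-> (exists2 x, A x & g x = y) /\ P y) ->
  \sum_(y \in B) (1 : R) =
  (count (fun x => `[< P (g x) >]) (finmap.enum_fset (fset_set A)))%:R.
Proof.
move=> finA inj BE.
have -> : B = g @` (A `&` [set x | P (g x)]).
  apply/seteqP; split=> y; first by move=> /BE[[x Ax <-] Px]; exists x.
  by move=> [x [Ax Px] <-]; apply/BE; split=> //; exists x.
rewrite fsbig_image; last by move=> x x' /set_mem[Ax _] /set_mem[Ax' _]; apply: inj; exact: mem_set.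
rewrite fsbig_mkcondr fsbig_finite// -sum1_count natr_sum big_mkcond [RHS]big_mkcond.
by apply: eq_bigr => x _ /=; rewrite /mem /in_mem /= /in_set.
Qed.

Section Local.
Variables (V : countType) (nb : V -> seq V).
Hypothesis simp : simple_graph nb.
Hypothesis conn : connected_graph nb.
Hypothesis inf : infinite_set [set: V].
Notation deg := (deg nb).
Notation rooted := (rooted nb).
Notation conf := (conf nb).
Notation tree_of := (@tree_of V nb).

Lemma deg_gt0 x : (0 < deg x)%N.
Proof.
have [y yx] : exists y, y <> x.
  apply: contrapT => /forallNP H; apply: inf; apply: (@sub_finite_set _ _ [set x]).
    by move=> y _; apply: contrapT; exact: H.
  exact: finite_set1.
have [[|z s] [/= + lx]] := conn x y; first by case: yx.
by move=> /andP[xz _]; move: xz; rewrite /adj /Defs.deg; case: (nb x).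
Qed.

Lemma conf_lt_deg_all W d f x : rooted W d f -> (conf d f x < deg x)%N.
Proof.
move=> rt; have [/(conf_lt_deg rt)//|Wx] := pselect (W x).
by rewrite (conf_out rt Wx) deg_gt0.
Qed.

Lemma finite_stable (W : set V) : finite_set W ->
  finite_set [set eta : V -> nat | (forall x, ~ W x -> eta x = 0%N) /\
                      forall x, W x -> (eta x < deg x)%N].
Proof.
move=> finW; have [s us Ws] := finite_set_enum finW; have [B degB] := seq_bound deg s.
pose F (t : (size s).-tuple 'I_B.+1) x :=
  if x \in s then nth 0%N (map val t) (index x s) else 0%N.
apply: (@sub_finite_set _ _ (F @` [set` predT])); last first.
  by apply: finite_image; exact: finite_finpred.
move=> eta [e0 est]; exists (map_tuple (fun x => inord (eta x)) (in_tuple s)) => //.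
apply/funext => x; rewrite /F; case: ifPn => xs; last by rewrite e0// => /Ws; apply/negP.
rewrite /= -map_comp (nth_map x) ?index_mem// nth_index//= inordK//.
have /Ws/est xdeg := xs.
by rewrite ltnS (leq_trans (ltnW xdeg)) ?degB.
Qed.

Definition rooted_pairs (W : set V) := [set p : (V -> nat) * (V -> V) | rooted W p.1 p.2].

Lemma conf_set_inj W : set_inj (rooted_pairs W) (fun p => conf p.1 p.2).
Proof.
move=> [d f] [d' f'] /set_mem rt /set_mem rt' E.
by have [-> ->] := conf_inj (rt : rooted W d f) (rt' : rooted W d' f') E.
Qed.

Lemma tree_of_set_inj Vn (n : nat) : set_inj (rooted_pairs (Vn n)) (fun p => tree_of p.2).
Proof.
move=> [d f] [d' f'] /set_mem rt /set_mem rt' E.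
by have [-> ->] := tree_of_inj simp (rt : rooted (Vn n) d f) (rt' : rooted (Vn n) d' f') E.
Qed.

Lemma finite_rooted_pairs W : finite_set W -> finite_set (rooted_pairs W).
Proof.
move=> finW; have := finite_stable finW.
set S := [set eta | _] => finS.
have fin_im : finite_set ((fun p => conf p.1 p.2) @` rooted_pairs W).
  apply: sub_finite_set finS => _ [[d f] rt <-]; split=> x Wx; last exact: conf_lt_deg rt Wx.
  exact: conf_out rt Wx.
by rewrite -(eq_finite_set (inj_card_eq (@conf_set_inj W))).
Qed.

Definition enum_rooted W : seq _ := finmap.enum_fset (fset_set (rooted_pairs W)).

Lemma in_enum_rooted W p : finite_set W -> (p \in enum_rooted W) <-> rooted_pairs W p.
Proof.
move=> /finite_rooted_pairs fin; have := in_fset_set fin p; rewrite /enum_rooted => ->.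
by rewrite inE.
Qed.

Section Freq.
Variable R : realType.

(** The uniform probability on orientations, which the two bijections turn into the tree measure and
    into the sandpile measure. *)
Definition freq (W : set V) (Q : (V -> nat) * (V -> V) -> Prop) : R :=
  (count (fun p => `[< Q p >]) (enum_rooted W))%:R / (size (enum_rooted W))%:R.

Lemma size_enum_rooted_gt0 W : finite_set W -> (0 < size (enum_rooted W))%N.
Proof.
move=> fin; have [d [f rt]] := @exists_rooted V nb simp (fun=> W) 0 conn inf fin.
have : (d, f) \in enum_rooted W.
  by rewrite in_enum_rooted.
by case: (enum_rooted W).
Qed.

Lemma freq_le W (Q Q' : (V -> nat) * (V -> V) -> Prop) : finite_set W ->
  (forall p, rooted_pairs W p -> Q p -> Q' p) -> freq W Q <= freq W Q'.
Proof.
move=> fin sub; rewrite ler_wpM2r ?invr_ge0// ler_nat.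
rewrite -!size_filter; apply: uniq_leq_size.
  by rewrite filter_uniq ?finmap.fset_uniq.
move=> p; rewrite !mem_filter => /andP[/asboolP Qp pW]; rewrite pW andbT; apply/asboolP.
by apply: sub Qp; rewrite -in_enum_rooted.
Qed.

Lemma freqUI W (Q Q' : (V -> nat) * (V -> V) -> Prop) :
  freq W (fun p => Q p \/ Q' p) + freq W (fun p => Q p /\ Q' p) = freq W Q + freq W Q'.
Proof.
rewrite -!mulrDl -!natrD; congr (_%:R / _).
rewrite -[RHS]count_predUI; congr (_ + _)%N; apply: eq_count => p /=.
  by rewrite asbool_or.
by rewrite asbool_and.
Qed.

Lemma freqC W (Q : (V -> nat) * (V -> V) -> Prop) : finite_set W ->
  freq W Q + freq W (fun p => ~ Q p) = 1.
Proof.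
move=> /size_enum_rooted_gt0 s0; rewrite -mulrDl -natrD.
rewrite [X in (_ + X)%N](_ : _ = count (predC (fun p => `[< Q p >])) (enum_rooted W)).
  by rewrite count_predC divff// pnatr_eq0 -lt0n.
by apply: eq_count => p /=; rewrite asbool_neg.
Qed.

Lemma eq_freq W (Q Q' : (V -> nat) * (V -> V) -> Prop) : (forall p, Q p <-> Q' p) ->
  freq W Q = freq W Q'.
Proof. by move=> /(_ _)/propext QQ'; rewrite (_ : Q = Q')//; apply/funext. Qed.

Lemma freq0 W : freq W (fun=> False) = 0.
Proof.
by rewrite /freq (eq_count (a2 := pred0)) ?count_pred0 ?mul0r// => p; rewrite asboolF.
Qed.

Section Exhaust.
Variables (Vn : nat -> set V).
Hypothesis exh : exhaustion Vn.
Let fin n : finite_set (Vn n). Proof. by case: exh. Qed.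

Lemma sandpile_cyl_freq n F xi : @sandpile_cyl V nb Vn n R F xi =
  freq (Vn n) (fun p => forall x, x \in F -> conf p.1 p.2 x = xi x).
Proof.
have E eta : recurrent nb Vn n eta <->
    exists2 p, rooted_pairs (Vn n) p & conf p.1 p.2 = eta.
  rewrite (recurrent_conf simp conn inf (fin n)).
  split=> [[d [f [rt ->]]]|[[d f] rt <-]]; first by exists (d, f).
  by exists d, f.
rewrite /sandpile_cyl /freq -count_predT.
rewrite (fsum1_image R (P := fun eta => forall x, x \in F -> eta x = xi x)
  (finite_rooted_pairs (fin n)) (@conf_set_inj _)); last first.
  by move=> eta /=; rewrite E.
rewrite (fsum1_image R (P := fun=> True) (finite_rooted_pairs (fin n)) (@conf_set_inj _)).
  by rewrite (@eq_count _ (fun x => `[< True >]) predT)// => p; rewrite asboolT.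
by move=> eta /=; rewrite E; split=> [?|[]].
Qed.

Lemma ust_cyl_freq n F w0 : @ust_cyl V nb Vn n R F w0 =
  freq (Vn n) (fun p => forall e, e \in F -> tree_of p.2 e = w0 e).
Proof.
have E T : spanning_tree Vn n T <->
    exists2 p, rooted_pairs (Vn n) p & tree_of p.2 = T.
  rewrite (spanning_treeP simp).
  split=> [[d [f [rt ->]]]|[[d f] rt <-]]; first by exists (d, f).
  by exists d, f.
rewrite /ust_cyl /freq -count_predT.
rewrite (fsum1_image R (P := fun T => forall e, e \in F -> T e = w0 e)
  (finite_rooted_pairs (fin n)) (@tree_of_set_inj _ _)); last first.
  by move=> T /=; rewrite E.
rewrite (fsum1_image R (P := fun=> True) (finite_rooted_pairs (fin n)) (@tree_of_set_inj _ _)).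
  by rewrite (@eq_count _ (fun x => `[< True >]) predT)// => p; rewrite asboolT.
by move=> T /=; rewrite E; split=> [?|[]].
Qed.

Lemma exhaustion_eventually (N : seq V) :
  exists n0, forall n, (n0 <= n)%N -> forall x, x \in N -> Vn n x.
Proof.
have [_ incr ex] := exh; have [k kP] := choice ex; have [B kB] := seq_bound k N.
exists B => n Bn x /kB kx; have := kP x; rewrite -(subnK (leq_trans kx Bn)).
elim: (n - k x)%N => [//|m IH] Vx; rewrite addSn.
by apply: incr; exact: IH.
Qed.

End Exhaust.
End Freq.

(** * Cylinder events that force heights *)

Definition cyl (L : seq (edge nb * bool)) : set (edge nb -> bool) :=
  [set w | forall p, p \in L -> w p.1 = p.2].

(** [L] fixes the state of finitely many edges, and [N] tells how large a wired graph must be for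
    them to imply [P], whatever the exhaustion. *)
Definition forces (P : (V -> nat) -> Prop) (L : seq (edge nb * bool)) : Prop :=
  exists N : seq V, forall W, finite_set W -> (forall x, x \in N -> W x) ->
    forall d f, rooted W d f -> cyl L (tree_of f) -> P (conf d f).

Definition event (P : (V -> nat) -> Prop) : set (edge nb -> bool) :=
  [set w | exists2 L, forces P L & cyl L w].

Lemma forces_imp (P Q : (V -> nat) -> Prop) L : (forall eta, P eta -> Q eta) ->
  forces P L -> forces Q L.
Proof. by move=> PQ [N H]; exists N => W fW NW d f rt /(H W fW NW d f rt)/PQ. Qed.

(** [L] records the state in [w] of all edges touching a set [D] that contains [F] and its
    neighbours and is left by a single tree edge; [conf_agree] then fixes the heights on [F]. *)
Lemma one_ended_forces w (F : seq V) : one_ended_spanning_tree w ->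
  exists L xi, [/\ cyl L w, forall x, (xi x < deg x)%N &
    forces (fun eta => forall x, x \in F -> eta x = xi x) L].
Proof.
move=> w1; have [D [z [z' [finD KD cross]]]] :=
  exists_cut simp inf w1 (F ++ flatten [seq nb x | x <- F]).
have [N _ DN] := finite_set_enum finD.
have [es esP] : exists es : seq (edge nb), forall e x y, ends e x y -> D x -> e \in es.
  have next (p : V * V) : exists o : option (edge nb),
      forall e, ends e p.1 p.2 -> o = Some e.
    have [[e E]|ne] := pselect (exists e : edge nb, ends e p.1 p.2).
      by exists (Some e) => e' /(ends_inj E)->.
    by exists None => e E; case: ne; exists e.
  have [h hP] := choice next.
  exists (pmap h [seq (x, y) | x <- N, y <- nb x]) => e x y exy /DN xN.
  rewrite mem_pmap; apply/mapP; exists (x, y).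
    by apply/allpairsPdep; exists x, y; split=> //; exact: ends_adj exy.
  by rewrite (hP (x, y) e).
pose L := [seq (e, w e) | e <- es].
have agreeL f e x y : cyl L (tree_of f) -> ends e x y -> D x -> tree_of f e = w e.
  move=> Lf exy Dx; apply: (Lf (e, w e)); apply/mapP; exists e => //.
  exact: esP exy Dx.
have same W W' d d' f f' x : (forall x, x \in N -> W x) -> (forall x, x \in N -> W' x) ->
    rooted W d f -> rooted W' d' f' -> cyl L (tree_of f) -> cyl L (tree_of f') ->
    x \in F -> conf d f x = conf d' f' x.
  move=> NW NW' rt rt' Lf Lf' xF.
  apply: (conf_agree (D := D) (z := z) (z' := z') simp rt rt').
  - by move=> y /DN/NW.
  - by move=> y /DN/NW'.
  - by move=> e a b eab Da; rewrite (agreeL f e a b)// (agreeL f' e a b).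
  - by move=> e a b eab Da Db; rewrite (agreeL f e a b)//; exact: cross eab Da Db.
  - by apply: KD; rewrite mem_cat xF.
  - move=> y ynb; apply: KD; rewrite mem_cat; apply/orP; right.
    by apply/flattenP; exists (nb x) => //; apply/mapP; exists x.
have Lw : cyl L w by move=> _ /mapP[e _ ->].
(* The values [xi] are read off any compatible orientation; if there is none, [L] forces everything
   vacuously and 0 will do. *)
have [[W0 [d0 [f0 [NW0 rt0 L0]]]]|no] := pselect (exists W0 d0 f0,
    [/\ forall x, x \in N -> W0 x, rooted W0 d0 f0 & cyl L (tree_of f0)]).
  exists L, (conf d0 f0); split=> //; first by move=> x; exact: conf_lt_deg_all rt0.
  by exists N => W _ NW d f rt Lf x xF; apply: (same W W0 d d0 f f0 x).
exists L, (fun=> 0%N); split=> //; first exact: deg_gt0.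
by exists N => W _ NW d f rt Lf; case: no; exists W, d, f.
Qed.

End Local.

(** * The limit measure *)

Section Probability.
Context d (T : measurableType d) (R : realType) (mu : probability T R).

Lemma probability_EFin (A : set T) : measurable A -> mu A = (fine (mu A))%:E.
Proof. by move=> mA; rewrite fineK// fin_num_measure. Qed.

Lemma fine_probabilityUI (A B : set T) : measurable A -> measurable B ->
  fine (mu (A `|` B)) + fine (mu (A `&` B)) = fine (mu A) + fine (mu B).
Proof.
move=> mA mB; have fA := fin_num_measure mu _ mA; have fB := fin_num_measure mu _ mB.
have fI := fin_num_measure mu _ (measurableI _ _ mA mB).
have ltA : (mu A < +oo)%E by rewrite ltey_eq fA.
by rewrite (measureUfinl mA mB ltA) fineB ?fineD ?fin_numD ?fA// subrK.
Qed.

Lemma ae_eq_probability (A B : set T) : measurable A -> measurable B ->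
  {ae mu, forall w, A w <-> B w} -> mu A = mu B.
Proof.
move=> mA mB AB.
have null (C D : set T) : measurable C -> measurable D ->
    {ae mu, forall w, C w <-> D w} -> mu C = mu (C `&` D).
  move=> mC mD CD; rewrite (measureDI mu mC mD) [X in (X + _)%E](_ : _ = 0%E) ?add0e//.
  apply: measure_negligible; first exact: measurableD.
  by apply: negligibleS CD => w [Cw Dw] /= H; apply/Dw/H.
rewrite (null A B)// (null B A)// 1?setIC//.
by apply: filterS AB => w [? ?]; split.
Qed.

Lemma ae_imply (P Q : T -> Prop) : (forall w, P w -> Q w) ->
  {ae mu, forall w, P w} -> {ae mu, forall w, Q w}.
Proof. by move=> PQ; apply: filterS. Qed.

Lemma ae_and (P Q : T -> Prop) : {ae mu, forall w, P w} ->
  {ae mu, forall w, Q w} -> {ae mu, forall w, P w /\ Q w}.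
Proof. by apply: filterS2 => w. Qed.

Lemma measurable_count (B : nat -> set T) (s : seq nat) (k : nat) :
  (forall j, measurable (B j)) ->
  measurable [set w | (\sum_(j <- s) `[< B j w >] = k)%N].
Proof.
move=> mB; elim: s k => [|j s IH] k.
  have [->|k0] := eqVneq k 0%N.
    rewrite (_ : [set w | _] = setT); first exact: measurableT.
    by apply/seteqP; split=> // w _ /=; rewrite big_nil.
  rewrite (_ : [set w | _] = set0); first exact: measurable0.
  by apply/seteqP; split=> // w /=; rewrite big_nil => /esym/eqP; rewrite (negbTE k0).
pose S k := [set w | (\sum_(j <- s) `[< B j w >] = k)%N].
rewrite (_ : [set w | _] = (B j `&` (if k is k'.+1 then S k' else set0)) `|` (~` B j `&` S k)).
  apply: measurableU; apply: measurableI => //; last 2 first.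
  - exact: measurableC.
  - exact: IH.
  by case: (k) => [|k']; [exact: measurable0|exact: IH].
apply/seteqP; split=> w /=; rewrite big_cons.
  have [Bw|Bw] := pselect (B j w).
    by rewrite asboolT// add1n => <-; left.
  by rewrite asboolF// add0n => <-; right.
move=> [[Bw]|[Bw Sk]]; last by rewrite asboolF.
by case: (k) => // k' Sk; rewrite asboolT// add1n Sk.
Qed.

End Probability.

Section Limit.
Variables (V : countType) (nb : V -> seq V).
Hypothesis simp : simple_graph nb.
Hypothesis conn : connected_graph nb.
Hypothesis inf : infinite_set [set: V].
Variable R : realType.
Variable mu : probability (edge_space nb) R.
Notation deg := (deg nb).
Notation rooted := (rooted nb).
Notation conf := (conf nb).
Notation tree_of := (@tree_of V nb).
Notation freq := (freq nb R).
Notation cyl := (@cyl V nb).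
Notation event := (@event V nb).
Notation forces := (@forces V nb).

Lemma measurable_cyl L : measurable (cyl L : set (edge_space nb)).
Proof.
elim: L => [|[e b] L IH].
  rewrite (_ : cyl [::] = setT); first exact: measurableT.
  by apply/seteqP; split.
rewrite (_ : cyl _ = [set w | w e = b] `&` cyl L).
  apply: measurableI => //; apply: sub_sigma_algebra.
  by exists e, b.
apply/seteqP; split=> w /=.
  move=> H; split; first by apply: (H (e, b)); rewrite mem_head.
  by move=> p pL; apply: H; rewrite inE pL orbT.
by move=> [we wL] p; rewrite inE => /predU1P[->|/wL].
Qed.

Definition cyls (Ls : seq (seq (edge nb * bool))) : set (edge nb -> bool) :=
  [set w | exists2 L, L \in Ls & cyl L w].

Lemma cyls_cons L Ls : cyls (L :: Ls) = cyl L `|` cyls Ls.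
Proof.
apply/seteqP; split=> w /=.
  by move=> [L']; rewrite inE => /predU1P[->|L's Lw]; [left|right; exists L'].
move=> [Lw|[L' L's Lw]]; first by exists L; rewrite ?mem_head.
by exists L'; rewrite ?inE ?L's ?orbT.
Qed.

Lemma cyl_cat L L' : cyl (L ++ L') = cyl L `&` cyl L'.
Proof.
apply/seteqP; split=> w /=.
  by move=> H; split=> p pL; apply: H; rewrite mem_cat pL ?orbT.
by move=> [H H'] p; rewrite mem_cat => /orP[/H|/H'].
Qed.

Lemma cyls_cat L Ls : cyls [seq L ++ L' | L' <- Ls] = cyl L `&` cyls Ls.
Proof.
apply/seteqP; split=> w /=.
  move=> [_ /mapP[L' L's ->]]; rewrite cyl_cat => -[Lw L'w]; split=> //.
  by exists L'.
move=> [Lw [L' L's L'w]]; exists (L ++ L'); first exact: map_f.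
by rewrite cyl_cat; split.
Qed.

Lemma measurable_cyls Ls : measurable (cyls Ls : set (edge_space nb)).
Proof.
elim: Ls => [|L Ls IH].
  rewrite (_ : cyls [::] = set0); first exact: measurable0.
  by apply/seteqP; split=> // w [].
by rewrite cyls_cons; apply: measurableU => //; exact: measurable_cyl.
Qed.

(** Restricting to the lists with code below [k] gives finite families that increase to the whole of
    [event P]. *)
Definition forcing (P : (V -> nat) -> Prop) (k : nat) : seq (seq (edge nb * bool)) :=
  [seq L <- pmap unpickle (iota 0 k) | `[< forces P L >]].

Lemma eventE P : event P = \bigcup_k cyls (forcing P k).
Proof.
apply/seteqP; split=> w /=.
  move=> [L PL Lw]; exists (pickle L).+1 => //; exists L => //.
  rewrite mem_filter asboolT// andTb mem_pmap; apply/mapP; exists (pickle L).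
    by rewrite mem_iota /= add0n.
  by rewrite pickleK.
by move=> [k _ [L]]; rewrite mem_filter => /andP[/asboolP PL _] Lw; exists L.
Qed.

Lemma measurable_event P : measurable (event P : set (edge_space nb)).
Proof. by rewrite eventE; apply: bigcup_measurable => k _; exact: measurable_cyls. Qed.

Lemma cyls_forcing_incr P : {homo (fun k => cyls (forcing P k)) : n m / (n <= m)%N >-> (n <= m)%O}.
Proof.
move=> k l kl; apply/subsetPset => w [L]; rewrite mem_filter => /andP[PL Lk] Lw.
exists L => //; rewrite mem_filter PL; move: Lk; rewrite !mem_pmap => /mapP[j jk ->].
by apply: map_f; move: jk; rewrite !mem_iota /= !add0n => /leq_trans->.
Qed.

(** * Convergence along an exhaustion *)

Section Cvg.
Hypothesis WSF : is_WSF mu.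
Variable Vn : nat -> set V.
Hypothesis exh : exhaustion Vn.

(** A consistent list is an edge pattern as in [is_WSF]; an inconsistent one describes the empty
    event. *)
Lemma cvg_cyl L :
  freq (Vn n) (fun p => cyl L (tree_of p.2)) @[n --> \oo] --> fine (mu (cyl L)).
Proof.
have [[w0 w0L]|no] := pselect (exists w0, cyl L w0).
  have E w : cyl L w <-> forall e, e \in map fst L -> w e = w0 e.
    split=> [wL _ /mapP[p pL ->]|H p pL]; first by rewrite wL// w0L.
    by rewrite H ?map_f// w0L.
  have := @WSF Vn exh (map fst L) w0.
  rewrite (_ : [set w | _] = cyl L); last by apply/seteqP; split=> w /E.
  rewrite (_ : (fun n => _) = (fun n => freq (Vn n) (fun p => cyl L (tree_of p.2))))//.
  apply/funext => n; rewrite (ust_cyl_freq simp R exh).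
  by apply: eq_freq => p; rewrite E.
have c0 : cyl L = set0 by apply/seteqP; split=> // w Lw; apply: no; exists w.
rewrite c0 measure0 /= (_ : (fun n => _) = fun=> 0); first exact: cvg_cst.
by apply/funext => n; rewrite -(freq0 nb R (Vn n)); apply: eq_freq.
Qed.

(** Inclusion-exclusion: intersecting a union of cylinders with one more cylinder gives a union of
    equally many, so induction on their number applies to both. *)
Lemma cvg_cyls Ls :
  freq (Vn n) (fun p => cyls Ls (tree_of p.2)) @[n --> \oo] --> fine (mu (cyls Ls)).
Proof.
have [k] := ubnP (size Ls); elim: k Ls => // k IH [|L Ls] /=.
  have -> : cyls [::] = set0 by apply/seteqP; split=> // w [].
  move=> _; rewrite measure0 /= (_ : (fun n => _) = fun=> 0); first exact: cvg_cst.
  by apply/funext => n; rewrite -(freq0 nb R (Vn n)); apply: eq_freq.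
rewrite ltnS => lek.
have cL := cvg_cyl (L := L); have cLs := IH Ls lek.
have cI := IH [seq L ++ L' | L' <- Ls]; rewrite size_map in cI.
have {}cI := cI lek.
have mUI := fine_probabilityUI mu (measurable_cyl L) (measurable_cyls Ls).
rewrite -cyls_cons -cyls_cat in mUI.
have -> : fine (mu (cyls (L :: Ls))) = fine (mu (cyl L)) + fine (mu (cyls Ls))
    - fine (mu (cyls [seq L ++ L' | L' <- Ls])).
  by rewrite -mUI addrK.
rewrite (_ : (fun n => _) = (fun n => freq (Vn n) (fun p => cyl L (tree_of p.2)) +
    freq (Vn n) (fun p => cyls Ls (tree_of p.2)) -
    freq (Vn n) (fun p => cyls [seq L ++ L' | L' <- Ls] (tree_of p.2)))).
  exact: cvgB (cvgD cL cLs) cI.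
apply/funext => n; rewrite -(freqUI nb R); apply/esym/eqP; rewrite subr_eq.
apply/eqP; congr (_ + _); first by apply: eq_freq => p; rewrite cyls_cons.
by apply: eq_freq => p; rewrite cyls_cat.
Qed.

(** Finitely many forcing cylinders carry the measure of [event P] up to [e / 2]. Their frequency
    converges, and once [Vn n] contains a suitable finite set each of them implies [P]. *)
Lemma freq_event_ge P (e : R) : 0 < e ->
  \forall n \near \oo, fine (mu (event P)) - e <= freq (Vn n) (fun p => P (conf p.1 p.2)).
Proof.
move=> e0; pose F k : set (edge_space nb) := cyls (forcing P k).
have mF k : measurable (F k) by exact: measurable_cyls.
have cF : fine (mu (F k)) @[k --> \oo] --> fine (mu (event P)).
  apply: fine_cvg; rewrite -probability_EFin; last exact: measurable_event.
  rewrite eventE; apply: nondecreasing_cvg_mu => //.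
    by rewrite -eventE; exact: measurable_event.
  exact: cyls_forcing_incr.
have e2 : 0 < e / 2 by rewrite divr_gt0.
have [k] : exists k, fine (mu (event P)) - e / 2 <= fine (mu (F k)).
  have /cvgrPdist_le/(_ _ e2)[k _ /(_ k (leqnn k))] := cF.
  by rewrite /= ler_distl => /andP[? ?]; exists k; lra.
move=> Fk; have /cvgrPdist_le/(_ _ e2) near_k := @cvg_cyls (forcing P k).
have [N NP] : exists N : seq V, forall W, finite_set W -> (forall x, x \in N -> W x) ->
    forall d f, rooted W d f -> cyls (forcing P k) (tree_of f) -> P (conf d f).
  have : forall L, L \in forcing P k -> forces P L.
    by move=> L; rewrite mem_filter => /andP[/asboolP].
  elim: (forcing P k) => [|L Ls IH] H; first by exists [::] => W _ _ d f _ [].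
  have [|N HN] := IH; first by move=> L' L's; apply: H; rewrite inE L's orbT.
  have [N' HN'] := H L (mem_head _ _).
  exists (N ++ N') => W fW NW d f rt; rewrite cyls_cons => -[Lf|Lsf].
    by apply: (HN' W fW) rt Lf => x xN; apply: NW; rewrite mem_cat xN orbT.
  by apply: (HN W fW) rt Lsf => x xN; apply: NW; rewrite mem_cat xN.
have [n0 n0P] := exhaustion_eventually exh N.
have finV n : finite_set (Vn n) by case: exh.
near=> n.
have n0n : (n0 <= n)%N by near: n; exists n0.
have : `|fine (mu (cyls (forcing P k))) - freq (Vn n) (fun p => cyls (forcing P k) (tree_of p.2))| <= e / 2.
  by near: n.
rewrite ler_distl => /andP[_ hi].
apply: le_trans (@freq_le V nb R (Vn n) (fun p => cyls (forcing P k) (tree_of p.2)) _ (finV n) _).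
  by rewrite /F in Fk; lra.
by move=> [dd f] rt; apply: NP rt => //; exact: n0P.
Unshelve. all: end_near. Qed.

End Cvg.

Hypothesis WSF : is_WSF mu.
Hypothesis mu1 : {ae mu, forall w, one_ended_spanning_tree w}.

(** * Local events are decided by the forest *)

Definition local (F : seq V) (P : (V -> nat) -> Prop) : Prop :=
  forall eta eta' : V -> nat, (forall x, x \in F -> eta x = eta' x) -> P eta -> P eta'.

Lemma one_ended_event F P w : local F P -> one_ended_spanning_tree w ->
  event P w \/ event (fun eta => ~ P eta) w.
Proof.
move=> loc /(one_ended_forces simp conn inf F)[L [xi [Lw _ HL]]].
have [Pxi|nPxi] := pselect (P xi); [left|right]; exists L => //; apply: forces_imp HL.
  by move=> eta E; apply: loc Pxi => x /E.
by move=> eta E Peta; apply: nPxi; apply: loc Peta => x /E.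
Qed.

Lemma exists_exhaustion : exists Vn : nat -> set V, exhaustion Vn.
Proof.
exists (fun n => [set x | (pickle x < n)%N]); split.
- move=> n; apply: (@sub_finite_set _ _ [set` pmap unpickle (iota 0 n)]).
    move=> x /= xn; rewrite mem_pmap; apply/mapP; exists (pickle x); last by rewrite pickleK.
    by rewrite mem_iota.
  exact: finite_seq.
- by move=> n x /=; exact: leqW.
- by move=> x; exists (pickle x).+1 => /=.
Qed.

(** The two events cover almost every forest, so their measures add up to at least 1. They bound
    from below frequencies with sum 1, so the sum is at most 1, and the overlap is null. *)
Lemma fine_event_compl F P : local F P ->
  fine (mu (event P)) + fine (mu (event (fun eta => ~ P eta))) = 1 /\
  mu (event P `&` event (fun eta => ~ P eta)) = 0%E.
Proof.
move=> loc; have [Vn exh] := exists_exhaustion.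
have mP := measurable_event P; have mnP := measurable_event (fun eta => ~ P eta).
have UI := fine_probabilityUI mu mP mnP.
have U1 : fine (mu (event P `|` event (fun eta => ~ P eta))) = 1.
  rewrite -[1]/(fine 1) -(probability_setT mu); congr fine.
  apply: ae_eq_probability; [exact: measurableU|exact: measurableT|].
  by apply: ae_imply mu1 => w /(one_ended_event loc) H; split.
have le1 : fine (mu (event P)) + fine (mu (event (fun eta => ~ P eta))) <= 1.
  apply/ler_addgt0Pl => e e0; have e2 : 0 < e / 2 by rewrite divr_gt0.
  have [n [H H']] : exists n, fine (mu (event P)) - e / 2 <= freq (Vn n) (fun p => P (conf p.1 p.2)) /\
      fine (mu (event (fun eta => ~ P eta))) - e / 2 <= freq (Vn n) (fun p => ~ P (conf p.1 p.2)).
    have [a _ Ha] := freq_event_ge WSF exh P e2.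
    have [b _ Hb] := freq_event_ge WSF exh (fun eta => ~ P eta) e2.
    exists (maxn a b); split; [apply: Ha|apply: Hb] => /=; first exact: leq_maxl.
    exact: leq_maxr.
  have finV : finite_set (Vn n) by case: exh.
  have := freqC simp conn inf R (fun p => P (conf p.1 p.2)) finV.
  by lra.
have I0 : 0 <= fine (mu (event P `&` event (fun eta => ~ P eta))).
  exact/fine_ge0/measure_ge0.
split; first by lra.
rewrite probability_EFin; last exact: measurableI.
by congr (_%:E); lra.
Qed.

(** The lower bound for the complementary event is an upper bound for this one, and the two meet in
    the limit. *)
Lemma cvg_freq_event F P Vn : local F P -> exhaustion Vn ->
  freq (Vn n) (fun p => P (conf p.1 p.2)) @[n --> \oo] --> fine (mu (event P)).
Proof.
move=> loc exh; apply/cvgrPdist_le => e e0.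
have [PnP _] := fine_event_compl loc.
have finV n : finite_set (Vn n) by case: exh.
near=> n.
have lo : fine (mu (event P)) - e <= freq (Vn n) (fun p => P (conf p.1 p.2)).
  by near: n; exact: freq_event_ge.
have hi : fine (mu (event (fun eta => ~ P eta))) - e <=
    freq (Vn n) (fun p => ~ P (conf p.1 p.2)).
  by near: n; exact: (freq_event_ge WSF exh).
have := freqC simp conn inf R (fun p => P (conf p.1 p.2)) (finV n).
by rewrite ler_distl => ?; apply/andP; split; lra.
Unshelve. all: end_near. Qed.

(** * Reading the heights off the forest *)

Definition height_ge (x : V) (j : nat) (eta : V -> nat) : Prop := (j <= eta x)%N.

(* Almost surely the [j > 0] with [event (height_ge x j) w] form an initial
   segment, and counting them recovers the height at [x]. *)
Definition limit_conf (w : edge nb -> bool) (x : V) : nat :=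
  (\sum_(j <- iota 1 (deg x).-1) `[< event (height_ge x j) w >])%N.

Lemma limit_conf_lt w x : (limit_conf w x < deg x)%N.
Proof.
have d0 := deg_gt0 conn inf x.
rewrite -[ltnRHS](prednK d0) ltnS -[leqRHS](size_iota 1) -[leqRHS]muln1.
by apply: leq_sum_const => j _; exact: leq_b1.
Qed.

Lemma measurable_limit_conf :
  measurable_fun [set: edge_space nb] (limit_conf : edge_space nb -> config_space V).
Proof.
apply: (@measurability _ _ (edge_space nb) (config_space V) setT limit_conf (@cyl_sets V nat)) => // _ [_ [x [k ->]] <-].
rewrite setTI.
apply: (@measurable_count _ (edge_space nb) (fun j => event (height_ge x j))
  (iota 1 (deg x).-1) k) => j.
exact: measurable_event.
Qed.

(** Almost surely one list forces heights [xi'] on all of [F]. As complementary events overlap in a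
    null set only, [height_ge x j] is then forced exactly for [j <= xi' x], and the count returns
    [xi' x]. *)
Lemma limit_conf_event (F : seq V) (xi : V -> nat) :
  mu [set w | forall x, x \in F -> limit_conf w x = xi x] =
  mu (event (fun eta => forall x, x \in F -> eta x = xi x)).
Proof.
pose P (eta : V -> nat) := forall x, x \in F -> eta x = xi x.
have locP : local F P by move=> eta eta' E H x xF; rewrite -E// H.
have locH x j : local [:: x] (height_ge x j).
  by move=> eta eta' E; rewrite /height_ge E// mem_head.
have ae_disj F' Q : local F' Q ->
    {ae mu, forall w, ~ (event Q w /\ event (fun eta => ~ Q eta) w)}.
  move=> /fine_event_compl[_ H]; exists (event Q `&` event (fun eta => ~ Q eta)).
  split=> //; first by apply: measurableI; exact: measurable_event.
  by move=> w /= /contrapT.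
have ae_height : {ae mu, forall w, forall x j,
    ~ (event (height_ge x j) w /\ event (fun eta => ~ height_ge x j eta) w)}.
  (* Coding the pairs [(x, j)] by naturals turns the statement into a countable intersection. *)
  have : {ae mu, forall w, forall k : nat, if unpickle k is Some (x, j) then
    ~ (event (height_ge x j) w /\ event (fun eta => ~ height_ge x j eta) w) else True}.
    apply: ae_foralln => k; case: unpickle => [[x j]|]; first exact: ae_disj (locH x j).
    exact: aeW.
  by apply: ae_imply => w H x j; have := H (pickle (x, j)); rewrite pickleK.
apply: ae_eq_probability; [|exact: measurable_event|].
  have := measurable_limit_conf; move=> mF.
  have mK : measurable [set eta : config_space V | P eta].
    rewrite /P; elim: (F) => [|x F' IH].
      rewrite (_ : [set eta | _] = setT); first exact: measurableT.
      by apply/seteqP; split.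
    rewrite (_ : [set eta | _] = [set eta : config_space V | eta x = xi x] `&`
        [set eta | forall x, x \in F' -> eta x = xi x]).
      by apply: measurableI => //; apply: sub_sigma_algebra; exists x, (xi x).
    apply/seteqP; split=> eta /= => [H|[Hx H] y].
      by split=> [|y yF]; apply: H; rewrite inE ?eqxx ?yF ?orbT.
    by rewrite inE => /predU1P[->|/H].
  by have := mF measurableT _ mK; rewrite setTI.
apply: ae_imply (ae_and mu1 (ae_and ae_height (ae_disj F P locP))) => w [w1 [wH wP]].
have [L [xi' [Lw xi'd HL]]] := one_ended_forces simp conn inf F w1.
have lim x : x \in F -> limit_conf w x = xi' x.
  move=> xF; rewrite /limit_conf.
  have E j : `[< event (height_ge x j) w >] = (j <= xi' x)%N.
    apply/asboolP/idP => [ev|le].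
      rewrite leqNgt; apply/negP => lt; apply: (wH x j); split=> //.
      exists L => //; apply: forces_imp HL => eta /(_ x xF) eE.
      by rewrite /height_ge eE; apply/negP; rewrite -ltnNge.
    by exists L => //; apply: forces_imp HL => eta /(_ x xF) eE; rewrite /height_ge eE.
  under eq_bigr do rewrite E.
  have sumE k m : (\sum_(j <- iota 1 m) (j <= k)%N)%N = minn k m.
    elim: m => [|m IH]; first by rewrite big_nil minn0.
    by rewrite -[m.+1]addn1 iotaD big_cat big_seq1 IH /=; case: (leqP (1 + m) k) => ?; lia.
  by rewrite sumE; apply/minn_idPl; have := xi'd x; lia.
split=> [H|[L' L'P L'w] x xF].
  exists L => //; apply: forces_imp HL => eta E x xF.
  by rewrite E// -lim// H.
rewrite lim//; apply: contrapT => ne; apply: wP; split; first by exists L'.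
exists L => //; apply: forces_imp HL => eta E /(_ x xF).
by rewrite E.
Qed.

End Limit.

Theorem theorem6p1 (R : realType) (V : countType) (nb : V -> seq V) :
  simple_graph nb -> connected_graph nb -> infinite_set [set: V] ->
  (exists mu : probability (edge_space nb) R,
      is_WSF mu /\ {ae mu, forall w, one_ended_spanning_tree w}) ->
  exists nu : probability (config_space V) R,
    nu (Omega nb) = 1%E /\
    forall Vn : nat -> set V, exhaustion Vn ->
      forall (F : seq V) (xi : V -> nat),
        ((fun n => @sandpile_cyl V nb Vn n R F xi) : nat -> R) @ \oo -->
          (fine (nu [set eta | forall x, x \in F -> eta x = xi x]) : R).
Proof.
move=> simp conn inf [mu [WSF mu1]].
have Xmem : (@limit_conf V nb : edge_space nb -> config_space V) \in mfun.
  by rewrite inE; exact: measurable_limit_conf.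
pose X : {mfun edge_space nb >-> config_space V} := mfun_Sub Xmem.
(* [limit_conf] stays below the degrees for every [w], so its law gives [Omega nb] full mass. *)
exists (distribution mu X); split.
  rewrite -(probability_setT mu); congr (mu _).
  by apply/seteqP; split=> // w _ x; exact: limit_conf_lt.
move=> Vn exh F xi.
pose P (eta : V -> nat) := forall x, x \in F -> eta x = xi x.
have locP : local F P by move=> eta eta' E H x xF; rewrite -E// H.
have := cvg_freq_event simp conn inf WSF mu1 locP exh.
rewrite -(limit_conf_event simp conn inf WSF mu1).
rewrite (_ : (fun n => _) = fun n => sandpile_cyl nb Vn n R F xi) //.
by apply/funext => n; rewrite (sandpile_cyl_freq simp conn inf R exh).
Qed.
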